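(* Let $G$ be a planar graph without cycles of length $\le 9$ (equivalently, of girth at least $10$). Then $G$ is $(8,2)$-total-threshold-colorable: for every edge-labeling $\ell$ of $G$ there is an $(8,2)$-threshold-coloring of $G$ with respect to $\ell$.
   Context: All graphs are finite and simple. An edge-labeling of $G=(V,E)$ is a map $\ell:E\to\{N,F\}$, partitioning $E$ into near edges $N$ and far edges $F$. For integers $r\ge1$, $t\ge0$, an $(r,t)$-threshold-coloring of $G$ with respect to $\ell$ is a map $c:V\to\{1,\dots,r\}$ such that for every edge $uv\in E$: $uv\in N$ iff $|c(u)-c(v)|\le t$. *)

(* Defs.v *)
From HB Require Import structures.
From mathcomp Require Import all_boot all_order all_algebra.
From mathcomp Require Import all_classical all_reals all_analysis.
Set Implicit Arguments.
Unset Strict Implicit.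
Unset Printing Implicit Defensive.
Import Order.TTheory GRing.Theory Num.Theory.
Import numFieldNormedType.Exports.

Local Open Scope classical_set_scope.
Local Open Scope ring_scope.

Record sgraph := SGraph {
  vertex :> finType;
  adj : rel vertex;
  adj_sym : symmetric adj;
  adj_irrefl : irreflexive adj }.

Definition edges (G : sgraph) : {set {set G}} :=
  [set E : {set G} | [exists u, exists v, adj u v && (E == [set u; v]%SET)]]%SET.

(* A cycle is listed by its vertices, so its length is [size p].  The bound
   [2 < size p] excludes the closed walk u, v, u along a single edge, which
   [ucycle] accepts. *)
Definition graph_cycle (G : sgraph) (p : seq G) : Prop :=
  ucycle (@adj G) p /\ (2 < size p)%N.

(* Jordan arcs, as point sets: homeomorphic images of [0, 1] (a continuous
   injection of a compact space into a Hausdorff one is an embedding). *)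
Definition is_arc (R : realType) (A : set (R * R)) (x y : R * R) : Prop :=
  exists f : R -> R * R,
    [/\ {within `[0, 1], continuous f},
        {in `[0, 1] &, injective f},
        f 0 = x, f 1 = y & f @` `[0, 1] = A].

(* A drawing of G in the plane.  [arc] is indexed by vertex sets; only its
   values at edges of G matter. *)
Record plane_drawing (R : realType) (G : sgraph)
    (pos : G -> R * R) (arc : {set G} -> set (R * R)) : Prop := {
  drawing_pos_inj : injective pos;
  drawing_arc : forall u v : G, adj u v ->
    is_arc (arc [set u; v]%SET) (pos u) (pos v);
  drawing_vertex : forall E : {set G}, E \in edges G ->
    forall w : G, arc E (pos w) -> w \in E;
  drawing_disjoint : forall E E' : {set G}, E \in edges G -> E' \in edges G ->
    E != E' -> arc E `&` arc E' `<=` pos @` [set w | w \in E /\ w \in E'] }.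

Definition planar (R : realType) (G : sgraph) : Prop :=
  exists (pos : G -> R * R) (arc : {set G} -> set (R * R)),
    plane_drawing pos arc.

Inductive edge_label := Near | Far.

(* Only the values at edges of G matter: every map from [edges G] to labels is
   the restriction of such a function. *)
Definition edge_labeling (G : sgraph) := {set G} -> edge_label.

Definition threshold_coloring (r t : nat) (G : sgraph) (l : edge_labeling G)
    (c : G -> nat) : Prop :=
  (forall v : G, (1 <= c v <= r)%N) /\
  (forall u v : G, adj u v ->
    (l [set u; v]%SET = Near <-> `|(c u)%:Z - (c v)%:Z| <= t%:Z)).

Definition total_threshold_colorable (r t : nat) (G : sgraph) : Prop :=
  forall l : edge_labeling G, exists c : G -> nat, threshold_coloring r t l c.

(* Main.v *)
Require Import Defs.
From mathcomp Require Import all_boot all_order all_algebra.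
From mathcomp Require Import all_classical all_reals all_analysis.
From mathcomp Require Import zify ring lra.

(* A drawing by arcs shows that G is a minor of a fine square grid: in a compact
   drawing everything disjoint is at positive distance, so the small cells met
   by the connected pieces of the drawing are linked sets of cells.  In the
   grid, the faces of a spanning minor (forest of contracted edges, one chosen
   edge per edge of G, all other edges deleted) are obtained by merging squares,
   and their boundaries are even edge sets of G; at least m - n + 2 faces, at
   least 10 edges on each by the girth and at most 2 faces per edge give
   4 m < 5 n.

   A minimal counterexample to the colouring theorem has no vertex such that
   the trees of small degree hanging at it always leave a common colour.  By
   discharging, the absence of these configurations forces 5 n <= 4 m. *)

Set Implicit Arguments.
Unset Strict Implicit.
Unset Printing Implicit Defensive.
Import Order.TTheory GRing.Theory Num.Theory.
Import numFieldNormedType.Exports.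

Local Open Scope nat_scope.

(** The grid stands in for the Jordan curve theorem: an arc is merely a homeomorphic image of an
    interval, whereas the squares, edges and corners of a grid are explicit and Euler's relation for
    them is an identity in k. Merged faces need not be bounded by cycles, so they are handled modulo
    2, through indicator functions of faces. The sparsity bound fixes the charge 4 deg v - 10: its
    total is at most 8 m - 10 n, which is negative. In the colouring part the obstacle is that the
    colours around a branch and the labels inside it are arbitrary. Only the list of colour sets
    that a branch may leave available at its vertex is kept. An edge offers two labels, so these
    lists are finite and the existence of a common colour is a computation. Choices made in
    different branches can be combined because the girth keeps the branches at a vertex disjoint and
    non-adjacent. A vertex of degree 3 with branches of kinds 0, 1, 2 is left out of the reducible
    patterns although it owes one unit too much; this is the origin of the bad kind, by which its
    third neighbour pays that unit. *)

(** * Minors of plane maps and the face count *)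

(** Identifying one more pair lowers the number of classes by at most one. The pairs will be the two
    sides of the deleted edges. *)
Lemma quotient_by_pairs (F : finType) (D : seq (F * F)) :
  exists cl : F -> F, (forall p, p \in D -> cl p.1 = cl p.2) /\
    #|F| <= #|[set cl f | f in F]%SET| + size D.
Proof.
elim: D => [|[f g] D [cl [clD leF]]].
  by exists id; split=> //; rewrite card_imset // addn0.
exists (fun x => if cl x == cl g then cl f else cl x); split.
  move=> p; rewrite inE => /predU1P[->|/clD ->] //=.
  by rewrite eqxx; case: ifP => // _.
apply: (leq_trans leF); rewrite /= addnS -addSn leq_add2r.
set A := [set _ | _ in _]%SET; set A' := [set _ | _ in _]%SET.
have sub : (A \subset cl g |: A')%SET.
  apply/fintype.subsetP => y /imsetP[x _ ->]; rewrite in_setU1.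
  case: eqP => //= ne; apply/imsetP; exists x => //.
  by case: eqP.
by apply: leq_trans (subset_leq_card sub) _; rewrite cardsU1; case: (_ \notin _).
Qed.

(** [rk] is the distance to [R] and [par] is the first step of a shortest path. *)
Lemma parent_pointers (V : finType) (e : rel V) (R : {set V}) :
  (forall x, exists2 r, r \in R & connect e x r) ->
  exists (par : V -> V) (rk : V -> nat),
    forall x, x \notin R -> e x (par x) /\ rk (par x) < rk x.
Proof.
move=> conn.
pose P x n := [exists p : n.-tuple V, path e x p && (last x p \in R)].
have exP x : exists n, P x n.
  have [r rR /connectP[p ep lr]] := conn x; exists (size p).
  by apply/existsP; exists (in_tuple p); rewrite /= ep -lr.
pose rk x := ex_minn (exP x).
have /choice[par Hpar] : forall x, exists y, x \notin R -> e x y /\ rk y < rk x.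
  move=> x; rewrite {2}/rk; case: ex_minnP => n /existsP[p /andP[ep lp]] _.
  case: (boolP (x \in R)) => [_|xR]; first by exists x.
  move: n p ep lp => [|n] p ep lp.
    by move: lp; rewrite (tuple0 p) /= (negbTE xR).
  case/tupleP: p ep lp => y p /= /andP[exy ep] lp.
  exists y => _; split=> //; rewrite /rk; case: ex_minnP => m _ /(_ n).
  rewrite ltnS; apply; apply/existsP; exists p; by rewrite ep.
by exists par, rk.
Qed.

Definition endpoints (V E : finType) (s t : E -> V) (e : E) : {set V} :=
  [set s e; t e]%SET.

Definition edge_rel (V E : finType) (s t : E -> V) : rel V :=
  fun x y => [exists e, (x == s e) && (y == t e) || (y == s e) && (x == t e)].

Lemma edge_rel_sym (V E : finType) (s t : E -> V) : symmetric (edge_rel s t).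
Proof. by move=> x y; apply: eq_existsb => e; rewrite orbC. Qed.

Lemma edge_relP (V E : finType) (s t : E -> V) x y :
  reflect (exists e, endpoints s t e = [set x; y]%SET) (edge_rel s t x y).
Proof.
apply: (iffP existsP) => [[e /orP[]/andP[/eqP-> /eqP->]]|[e Ee]]; exists e => //.
  by rewrite /endpoints finset.setUC.
have: x \in endpoints s t e by rewrite Ee !inE eqxx.
have: y \in endpoints s t e by rewrite Ee !inE eqxx orbT.
have: s e \in [set x; y]%SET by rewrite -Ee !inE eqxx.
have: t e \in [set x; y]%SET by rewrite -Ee !inE eqxx orbT.
rewrite !inE ![_ == s e]eq_sym ![_ == t e]eq_sym.
by do 4!case: (_ == _).
Qed.

Definition induced_rel (V : finType) (A : {set V}) (e : rel V) : rel V :=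
  [rel x y | [&& e x y, x \in A & y \in A]].

Lemma induced_rel_sym (V : finType) (A : {set V}) (e : rel V) :
  symmetric e -> symmetric (induced_rel A e).
Proof. by move=> es x y; rewrite /induced_rel /= es; congr (_ && _); rewrite andbC. Qed.

(* A graph embedded in the sphere, given by the endpoints and the two sides of
   its edges; the boundary of a set of faces is an even set of edges. *)
Record plane_map (V E F : finType) (s t : E -> V) (l r : E -> F) : Prop := {
  pm_loopless : forall e, s e != t e;
  pm_euler : #|E| + 2 <= #|V| + #|F|;
  pm_even : forall (chi : F -> bool) (v : V),
    \big[addb/false]_e (((s e == v) (+) (t e == v)) && (chi (l e) (+) chi (r e)))
      = false;
  pm_dual_connected : forall chi : F -> bool,
    (forall e, chi (l e) = chi (r e)) -> forall f g, chi f = chi g;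
  pm_connected : forall x y, connect (edge_rel s t) x y }.

Record minor_model (V : finType) (e : rel V) (G : sgraph)
    (root : G -> V) (B : G -> {set V}) : Prop := {
  mm_root : forall v, root v \in B v;
  mm_conn : forall v x, x \in B v -> connect (induced_rel (B v) e) x (root v);
  mm_disj : forall u v x, x \in B u -> x \in B v -> u = v;
  mm_adj : forall u v, adj u v -> exists x y, [/\ x \in B u, y \in B v & e x y] }.

(* The trees grown from the roots cover all of the host graph, so contracting
   them loses no Euler characteristic. *)
Lemma spanning_minor (V : finType) (e : rel V) (G : sgraph) (root : G -> V)
  (B : G -> {set V}) (v0 : G) :
  (forall x y, connect e x y) -> @minor_model V e G root B ->
  exists (lab : V -> G) (par : V -> V) (rk : V -> nat),
    [/\ forall v, lab (root v) = v,
        forall x, x != root (lab x) ->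
          [/\ e x (par x), lab (par x) = lab x & rk (par x) < rk x] &
        forall u v, adj u v -> exists x y, [/\ lab x = u, lab y = v & e x y]].
Proof.
move=> conn [Br Bc Bd Ba].
pose cov x := [exists v, x \in B v].
(* A vertex in a branch set may step only inside that branch set, an uncovered vertex may step
   anywhere. Trees grown along [e'] thus absorb the uncovered vertices without mixing the branch
   sets. *)
pose e' := [rel x y | e x y && (cov x ==> [exists v, (x \in B v) && (y \in B v)])].
have e'B v x : x \in B v -> connect e' x (root v).
  move=> xB; apply: connect_sub (Bc v x xB) => y z /= /and3P[eyz yB zB].
  apply: connect1; rewrite /= eyz /=; apply/implyP => _.
  by apply/existsP; exists v; rewrite yB.
pose R := [set root v | v in G]%SET.
have [x|par [rk parP]] := @parent_pointers V e' R.
  have /connectP[p ep lp] := conn x (root v0).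
  suff: exists v, connect e' x (root v).
    by case=> v cv; exists (root v) => //; apply: imset_f.
  elim: p x ep lp => [x _ /= <-|y p IH x /= /andP[exy ep] lp].
    by exists v0; apply: connect0.
  case: (boolP (cov x)) => [/existsP[v xv]|ncx]; first by exists v; apply: e'B.
  have [v cv] := IH y ep lp; exists v; apply: connect_trans cv.
  by apply: connect1; rewrite /= exy (negbTE ncx).
have rootinj : injective root.
  by move=> u v uv; by apply: (Bd _ _ (root u)); [|rewrite uv].
(* The label of a vertex is the root at which its chain of parents first enters [R]; stopping at the
   first entry makes the label unique. *)
have /choice[lab labP] : forall x, exists v, exists2 n, iter n par x = root v &
    forall i, i < n -> iter i par x \notin R.
  move=> x; move: {2}(rk x) (leqnn (rk x)) => n; elim: n x => [|n IH] x le.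
    case: (boolP (x \in R)) => [/imsetP[v _ ->]|/parP[_]].
      by exists v, 0.
    by move: le; rewrite leqn0 => /eqP->.
  case: (boolP (x \in R)) => [/imsetP[v _ ->]|xR]; first by exists v, 0.
  have [_ lt] := parP x xR.
  have [|v [m e1 e2]] := IH (par x); first by rewrite -ltnS (leq_trans lt).
  exists v, m.+1; first by rewrite iterSr.
  by case=> [|i] //; rewrite ltnS iterSr; apply: e2.
have stop x u v m n : iter m par x = root u -> iter n par x = root v ->
  (forall i, i < m -> iter i par x \notin R) ->
  (forall i, i < n -> iter i par x \notin R) -> u = v.
  have inR w : root w \in R by apply: imset_f.
  move=> em en nm nn; case: (ssrnat.ltngtP m n) => [lt|gt|mn].
  - by have := nn m lt; rewrite em inR.
  - by have := nm n gt; rewrite en inR.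
  by apply: rootinj; rewrite -em -en mn.
have labroot v : lab (root v) = v.
  have [n e1 e2] := labP (root v).
  by apply: (stop (root v) _ _ n 0).
have labpar x : x \notin R -> lab (par x) = lab x.
  move=> xR; have [n e1 e2] := labP x; have [m e3 e4] := labP (par x).
  apply: (stop x _ _ m.+1 n) => //; first by rewrite iterSr.
  by case=> [|i] //; rewrite ltnS iterSr; apply: e4.
have labB x v : x \in B v -> lab x = v.
  move: {2}(rk x) (leqnn (rk x)) => n; elim: n x => [|n IH] x le xB.
    case: (boolP (x \in R)) => [/imsetP[w _ xw]|/parP[_]].
      by rewrite xw labroot; apply: (Bd _ _ x); rewrite // xw.
    by move: le; rewrite leqn0 => /eqP->.
  case: (boolP (x \in R)) => [/imsetP[w _ xw]|xR].
    by rewrite xw labroot; apply: (Bd _ _ x); rewrite // xw.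
  have [/= /andP[_ /implyP ]] := parP x xR.
  have -> : cov x by apply/existsP; exists v.
  case/(_ isT)/existsP => w /andP[xw yw] lt.
  rewrite -(labpar x xR); apply: IH.
    by rewrite -ltnS (leq_trans lt).
  by rewrite -(Bd _ _ _ xw xB).
exists lab, par, rk; split=> //.
  move=> x xr; have xR : x \notin R.
    by apply: contra xr => /imsetP[v _ ->]; rewrite labroot.
  by have [/= /andP[? _] ?] := parP x xR; split=> //; apply: labpar.
move=> u v uv; have [x [y [xu yv exy]]] := Ba u v uv.
by exists x, y; split=> //; apply: labB.
Qed.

Lemma edgesP (G : sgraph) (E : {set G}) :
  reflect (exists u v, adj u v /\ E = [set u; v]%SET) (E \in edges G).
Proof.
rewrite inE; apply: (iffP existsP) => [[u /existsP[v /andP[uv /eqP ->]]]|].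
  by exists u, v.
by case=> u [v [uv ->]]; exists u; apply/existsP; exists v; rewrite uv eqxx.
Qed.

Lemma odd_card_setE (T : finType) (A : {set T}) :
  odd #|A| = \big[addb/false]_x (x \in A).
Proof.
rewrite -sum1_card big_mkcond /=.
by elim/big_rec2: _ => // x b n _ <-; rewrite oddD; case: (x \in A).
Qed.

(** The girth enters as a lower bound on nonempty even edge sets, since that is all that is known
    about the boundary of a merged face. *)
Lemma minor_sparse (V E F : finType) (s t : E -> V) (l r : E -> F)
  (G : sgraph) (root : G -> V) (B : G -> {set V}) (v0 : G) :
  plane_map s t l r -> minor_model (edge_rel s t) root B ->
  (forall b : {set {set G}}, b \subset edges G -> b != finset.set0 ->
    (forall v, ~~ odd #|[set A in b | v \in A]%SET|) -> 10 <= #|b|) ->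
  4 * #|edges G| < 5 * #|G|.
Proof.
move=> pm mm; move: (@edgesP G); move: (edges G) => EG EGP girth.
have [lab [par [rk [labroot parP adjP]]]] := spanning_minor v0 (pm_connected pm) mm.
have G0 : 0 < #|G| by apply/card_gt0P; exists v0.
case: (set_0Vmem EG) => [->|[E0 E0G]].
  by rewrite cards0 muln0 muln_gt0.
have edge_host A : A \in EG ->
    exists e, [set lab (s e); lab (t e)]%SET = A.
  case/EGP => u [v [uv ->]]; have [x [y [<- <- /edge_relP[e ee]]]] := adjP _ _ uv.
  exists e; have := congr1 (fun X : {set V} => lab @: X) ee.
  by rewrite /endpoints !imsetU !imset_set1.
have [e0 _] := edge_host _ E0G.
have /choice[h hP] : forall A, exists e, A \in EG ->
    [set lab (s e); lab (t e)]%SET = A.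
  move=> A; case: (boolP (A \in EG)) => [/edge_host[e ee]|_]; last by exists e0.
  by exists e.
pose NR := [set x | x != root (lab x)]%SET.
have /choice[pe peP] : forall x, exists e, x \in NR ->
    endpoints s t e = [set x; par x]%SET.
  move=> x; case: (boolP (x \in NR)) => [|_]; last by exists e0.
  by rewrite inE => /parP[/edge_relP[e ee] _ _]; exists e.
have edge_card A : A \in EG -> #|A| = 2.
  case/EGP => u [v [uv ->]]; rewrite cards2.
  by case: eqP uv => // ->; rewrite adj_irrefl.
(* [T] consists of the contracted edges, [H] of the host edges representing the edges of [G]; every
   other edge is deleted. *)
pose T := pe @: NR; pose H := h @: EG.
have crossH A : A \in EG -> lab (s (h A)) != lab (t (h A)).
  move=> AG; have := edge_card A AG; rewrite -{1}(hP A AG) cards2.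
  by case: (_ != _).
have flatT e : e \in T -> lab (s e) = lab (t e).
  case/imsetP=> x xN ->; have: forall y, y \in endpoints s t (pe x) -> lab y = lab x.
    move=> y; rewrite peP // !inE => /orP[]/eqP-> //.
    by move: xN; rewrite inE => /parP[_ ->].
  by move=> Hy; rewrite !Hy // !inE eqxx ?orbT.
(* Two vertices with the same parent edge would be parents of each other, which the rank forbids; so
   [T] has one edge per vertex that is not a root. *)
have cardT : #|T| + #|G| = #|V|.
  rewrite card_in_imset; last first.
    move=> x y xN yN exy; apply/eqP/negPn/negP => nxy.
    have := peP x xN; rewrite exy (peP y yN) => eq.
    have /set2P[xy|xpy] : x \in [set y; par y]%SET by rewrite eq !inE eqxx.
      by rewrite xy eqxx in nxy.
    have /set2P[yx|ypx] : y \in [set x; par x]%SET by rewrite -eq !inE eqxx.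
      by rewrite yx eqxx in nxy.
    move: xN yN; rewrite !inE => /parP[_ _ r1] /parP[_ _ r2].
    by move: r1 r2; rewrite -xpy -ypx => /ltn_trans lt /lt; rewrite ltnn.
  have -> : NR = ~: (root @: [set: G]).
    apply/setP=> x; rewrite !inE; congr (~~ _); apply/eqP/imsetP.
      by move=> xr; exists (lab x).
    by case=> v _ ->; rewrite labroot.
  rewrite addnC -[X in X + _]cardsT -(card_imset _ (can_inj labroot)).
  by rewrite cardsC.
have hinj : {in EG &, injective h}.
  by move=> A1 A2 A1G A2G e12; rewrite -(hP _ A1G) -(hP _ A2G) e12.
have cardX : #|T :|: H| = #|T| + #|EG|.
  rewrite cardsU -(card_in_imset hinj) (_ : T :&: H = finset.set0) ?cards0 ?subn0 //.
  apply/setP=> e; rewrite !inE; apply/andP=> -[eT /imsetP[A AG eA]].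
  by have := crossH A AG; rewrite -eA (flatT e eT) eqxx.
pose D := [seq (l e, r e) | e <- enum (~: (T :|: H))].
have [cl [clD leF]] := quotient_by_pairs D.
set Phi := [set cl f | f in F]%SET in leF.
pose chi phi f := cl f == phi.
pose dl phi e := chi phi (l e) (+) chi phi (r e).
have dlX phi e : e \notin T :|: H -> dl phi e = false.
  move=> eX; rewrite /dl /chi.
  rewrite (clD (l e, r e)) ?addbb //; apply/mapP; exists e => //.
  by rewrite mem_enum inE.
pose b phi := [set A in EG | dl phi (h A)]%SET.
(* The parity identity is summed over all host vertices labelled [v]: contracted edges cancel, since
   both ends have the same label, and deleted edges have equal sides after merging. *)
have b_even phi v : ~~ odd #|[set A in b phi | v \in A]%SET|.
  suff -> : odd #|[set A in b phi | v \in A]%SET| = false by [].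
  have <- : \big[addb/false]_(x | lab x == v) false = false by rewrite big1_eq.
  rewrite -(eq_bigr _ (fun x _ => pm_even pm (chi phi) x)) exchange_big /=.
  transitivity (\big[addb/false]_e
     (((lab (s e) == v) (+) (lab (t e) == v)) && dl phi e)); last first.
    apply: eq_bigr => e _; rewrite -big_distrl /=; congr (_ && _).
    rewrite big_split /=; congr addb.
      case: eqP => [<-|ne].
        rewrite (bigD1 (s e)) //= eqxx big1 // => x /andP[_].
        by rewrite eq_sym => /negbTE.
      by rewrite big1 // => x /eqP lx; apply/eqP => sx; rewrite sx in ne.
    case: eqP => [<-|ne].
      rewrite (bigD1 (t e)) //= eqxx big1 // => x /andP[_].
      by rewrite eq_sym => /negbTE.
    by rewrite big1 // => x /eqP lx; apply/eqP => sx; rewrite sx in ne.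
  rewrite (bigID (fun e => e \in H)) /= [X in _ (+) X]big1 ?addbF; last first.
    move=> e eH; case: (boolP (e \in T)) => [/flatT ->|eT]; first by rewrite addbb.
    by rewrite dlX ?andbF // inE negb_or eT.
  rewrite (big_imset _ hinj) /= odd_card_setE (bigID (fun A => A \in EG)) /=.
  rewrite [X in _ (+) X]big1 ?addbF; last by move=> A /negbTE AG; rewrite !inE AG.
  apply: eq_bigr => A AG; rewrite !inE AG /= andbC; congr (_ && _).
  rewrite -{1}(hP A AG) !inE ![_ == v]eq_sym.
  case: eqP => [->|_] /=; last by [].
  by rewrite (negbTE (crossH A AG)).
(* With an empty trace on [H], the boundary lies in the forest [T]. At a vertex of maximal rank
   whose parent edge belongs to it, that edge is the only boundary edge, against parity. So the
   boundary is empty and the dual connectivity leaves a single class. *)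
have b_neq0 phi : phi \in Phi -> #|Phi| != 1 -> b phi != finset.set0.
  case/imsetP=> f0 _ -> Phi1; apply: contraNneq Phi1 => b0.
  have dlT e : dl (cl f0) e -> e \in T.
    apply: contraTT => eT; case: (boolP (e \in H)) => [/imsetP[A AG ->]|eH].
      by move/setP/(_ A): b0; rewrite !inE AG /= => ->.
    by rewrite dlX // inE negb_or eT.
  have dl0 e : dl (cl f0) e = false.
    apply/negP => /[dup] de /dlT /imsetP[x1 x1N ex1]; rewrite ex1 in de.
    have Px : (x1 \in NR) && dl (cl f0) (pe x1) by rewrite x1N.
    case: (@arg_maxnP _ x1 (fun x => (x \in NR) && dl (cl f0) (pe x)) rk Px) =>
      x /andP[xN dx] xmax.
    have := pm_even pm (chi (cl f0)) x; rewrite (bigD1 (pe x)) //= big1 ?addbF.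
      have := peP x xN; rewrite /endpoints -/(dl _ _) dx andbT => eq.
      have: x \in [set s (pe x); t (pe x)]%SET by rewrite eq !inE eqxx.
      rewrite !inE ![x == _]eq_sym; have := pm_loopless pm (pe x).
      case: (eqVneq (s (pe x)) x) => [->|_] ll /=; last by move=> ->.
      by rewrite [t (pe x) == x]eq_sym (negbTE ll).
    move=> e1 ne; apply/negbTE/negP => /andP[xe /[dup] de1 /dlT /imsetP[y yN ey]].
    rewrite ey in de1 xe ne; have le : rk y <= rk x by apply: xmax; rewrite yN.
    have: x \in endpoints s t (pe y).
      by rewrite !inE ![x == _]eq_sym; case: (_ == _) xe => //= ->.
    rewrite peP // => /set2P[xy|xy]; first by rewrite xy eqxx in ne.
    move: yN; rewrite inE => /parP[_ _]; rewrite -xy ltnNge.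
    by rewrite le.
  apply/cards1P; exists (cl f0); apply/setP=> psi; rewrite finset.in_set1.
  have all0 f : cl f == cl f0.
    change (is_true (chi (cl f0) f)).
    rewrite (pm_dual_connected pm (chi := chi (cl f0)) _ f f0) /chi ?eqxx //.
    by move=> e; have := dl0 e; rewrite /dl /chi; do 2!case: (_ == _).
  by apply/imsetP/eqP => [[f _ ->]|->]; [apply/eqP|exists f0].
have sum_b : \sum_(phi in Phi) #|b phi| <= 2 * #|EG|.
  have -> : \sum_(phi in Phi) #|b phi| =
     \sum_(A in EG) \sum_(phi in Phi) dl phi (h A).
    rewrite exchange_big /=; apply: eq_bigr => phi _.
    rewrite -sum1_card [LHS]big_mkcond [RHS]big_mkcond /=.
    by apply: eq_bigr => A _; rewrite inE; case: (A \in _).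
  rewrite mulnC -sum_nat_const; apply: leq_sum => A _.
  apply: (@leq_trans (\sum_(phi in [set cl (l (h A)); cl (r (h A))]%SET) 1)).
    rewrite [leqLHS]big_mkcond [leqRHS]big_mkcond /=; apply: leq_sum => phi _.
    rewrite !inE /dl /chi ![_ == phi]eq_sym.
    by case: (phi \in Phi) => //; case: (_ == _); case: (_ == _).
  by rewrite sum1_card cards2; case: (_ != _).
(* Contracting an edge of [T] loses one vertex, deleting an edge loses at most one face, so the
   Euler inequality survives. *)
have cardF : #|EG| + 2 <= #|Phi| + #|G|.
  have := pm_euler pm; move: leF; rewrite size_map -cardE.
  have := cardsC (T :|: H); rewrite cardX => eqE le1 le2.
  move: eqE le1 le2 cardT; move: #|E| #|F| #|V| #|T| #|_| #|~: _|%nat => *; lia.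
(* A single class has no boundary to count, but then m < n already. *)
case: (eqVneq #|Phi| 1) => Phi1; first by rewrite Phi1 in cardF; lia.
have: #|Phi| * 10 <= \sum_(phi in Phi) #|b phi|.
  rewrite -sum_nat_const; apply: leq_sum => phi phiP; apply: girth.
  - by apply/fintype.subsetP => A; rewrite inE => /andP[].
  - exact: b_neq0.
  - exact: b_even.
lia.
Qed.

(** * Walks without backtracking, and the size of even edge sets *)

Lemma path_walk (T : Type) (e : rel T) (x : nat -> T) m d :
  (forall i, m <= i < m + d -> e (x i) (x i.+1)) ->
  path e (x m) [seq x i | i <- iota m.+1 d].
Proof.
elim: d m => [//|d IH] m H /=; rewrite H ?IH //.
  by move=> i /andP[lt1 lt2]; apply: H; lia.
lia.
Qed.

Definition girth_gt9 (G : sgraph) :=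
  forall p : seq G, graph_cycle p -> ~~ (size p <= 9).

(** A shortest return closes a cycle: by induction the vertices in between are distinct. Lengths 1
    and 2 are excluded by irreflexivity and by the absence of backtracking. *)
Lemma nonbacktracking_neq (G : sgraph) (x : nat -> G) n d i :
  girth_gt9 G -> d <= 9 ->
  (forall i, i < n -> adj (x i) (x i.+1)) ->
  (forall i, i.+1 < n -> x i != x i.+2) ->
  0 < d -> i + d <= n -> x i != x (i + d).
Proof.
move=> girthG le9 xadj xnb; elim/ltn_ind: d i le9 => d IH i le9 d0 le.
apply/eqP => eqx; case: d => [|[|[|d]]] in IH le9 d0 le eqx => //.
- have := xadj i; rewrite addn1 in eqx le.
  by rewrite -eqx adj_irrefl => /(_ le).
- have := xnb i; rewrite addn2 in eqx le.
  by rewrite -eqx eqxx => /(_ le).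
have := girthG [seq x j | j <- iota i d.+3]; rewrite size_map size_iota le9.
suff cyc : graph_cycle [seq x j | j <- iota i d.+3] by move=> /(_ cyc).
split; last by rewrite size_map size_iota.
apply/andP; split.
  rewrite [iota i d.+3]/= map_cons /cycle eqx.
  have -> : rcons [seq x j | j <- iota i.+1 d.+2] (x (i + d.+3)) =
            [seq x j | j <- iota i.+1 d.+3].
    rewrite -[d.+3 in RHS](addn1) iotaD map_cat cats1 /=.
    by congr (_ :: _ :: rcons _ (x _)); lia.
  by rewrite -eqx; apply: path_walk => j /andP[_ lt]; apply: xadj; lia.
rewrite map_inj_in_uniq ?iota_uniq // => j k; rewrite !mem_iota.
wlog: j k / j < k.
  move=> H jP kP e; case: (ssrnat.ltngtP j k) => // lt; first exact: H.
  by symmetry; apply: H.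
move=> lt /andP[ij _] /andP[_ ki] e.
have lt_kj : k - j < d.+3 by lia.
have := IH (k - j) lt_kj j; rewrite (subnKC (ltnW lt)) e eqxx => H.
suff : false by [].
by apply: H; lia.
Qed.

(** By parity, a walk entering a vertex along an edge of [b] can leave it along another one, so a
    walk without backtracking in [b] never stops. The girth makes its first ten edges distinct. *)
Lemma even_subgraph_size (G : sgraph) (b : {set {set G}}) :
  girth_gt9 G -> b \subset edges G -> b != finset.set0 ->
  (forall v, ~~ odd #|[set A in b | v \in A]%SET|) -> 10 <= #|b|.
Proof.
move=> girthG; move: (@edgesP G); move: (edges G) => EG EGP.
move=> /fintype.subsetP bE /set0Pn[A0 A0b] even.
have /EGP[u0 [v0 [uv0 A0E]]] := bE _ A0b; rewrite {}A0E in A0b.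
have next (x y : G) : [set x; y]%SET \in b ->
    exists z, [&& z != x, adj y z & [set y; z]%SET \in b].
  move=> xyb; have := even y.
  rewrite (cardsD1 [set x; y]%SET) !inE eqxx orbT xyb /= negbK => odd1.
  have /card_gt0P[A] : 0 < #|[set A in b | y \in A]%SET :\ [set x; y]%SET|.
    by move: odd1; case: #|_|.
  rewrite !inE => /and3P[neq Ab yA].
  have /EGP[u [v [uv AE]]] := bE _ Ab; rewrite {}AE in neq Ab yA.
  have [z yz Auv] : exists2 z, adj y z & [set u; v]%SET = [set y; z]%SET.
    case/set2P: yA => ->; first by exists v.
    by exists u; rewrite 1?adj_sym // finset.setUC.
  exists z; rewrite -Auv Ab yz /= andbT; apply: contraNneq neq => zx.
  by rewrite Auv zx finset.setUC.
have /choice[nx nxP] : forall p : G * G, exists z, [set p.1; p.2]%SET \in b ->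
    [&& z != p.1, adj p.2 z & [set p.2; z]%SET \in b].
  case=> x y; case: (boolP ([set x; y]%SET \in b)) => [/next[z zP]|_].
    by exists z.
  by exists x.
pose w i := iter i (fun p : G * G => (p.2, nx p)) (u0, v0).
pose x i := (w i).1.
have w2 i : (w i).2 = x i.+1 by [].
have wb i : [set x i; x i.+1]%SET \in b.
  elim: i => [//|i IH]; have /and3P[_ _] := nxP (w i) IH; by [].
have xadj i : adj (x i) (x i.+1).
  by have /EGP := bE _ (wb i); case: i => [//|i] _; have /and3P[] := nxP (w i) (wb i).
have xnb i : x i != x i.+2.
  by rewrite eq_sym; have /and3P[] := nxP (w i) (wb i).
have xneq i j : 0 < j - i <= 9 -> x i != x j.
  move=> /andP[d0 d9]; have -> : j = i + (j - i) by lia.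
  by apply: (@nonbacktracking_neq G x j) => //; lia.
pose f (i : 'I_10) := [set x i; x i.+1]%SET.
have finj : injective f.
  suff H i j : i < j -> j < 10 -> [set x i; x i.+1]%SET != [set x j; x j.+1]%SET.
    move=> i j /eqP fij; apply/val_inj/eqP; apply: contraTT fij => /=.
    rewrite neq_ltn => /orP[lt|lt]; first by apply: H.
    by rewrite eq_sym; apply: H.
  move=> lt j10; apply/eqP => eq.
  have /set2P[/eqP|/eqP] : x i \in [set x j; x j.+1]%SET by rewrite -eq !inE eqxx.
    by apply/negP; apply: xneq; lia.
  (* Otherwise i = 0 and j = 9: [x 0] and [x 10] may coincide, so the other end [x 1] is compared
     with [x 9] and [x 10]. *)
  case: (ltnP (j.+1 - i) 10) => [?|ge]; first by apply/negP; apply: xneq; lia.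
  have : x i.+1 \in [set x j; x j.+1]%SET by rewrite -eq !inE eqxx orbT.
  by move=> /set2P[]/eqP + _; apply/negP; apply: xneq; lia.
rewrite -[10]card_ord -(card_imset _ finj); apply: subset_leq_card.
by apply/fintype.subsetP => _ /imsetP[i _ ->]; apply: wb.
Qed.

(* The part of S u v that can be reached from B u without entering B v is
   added to B u, for one of the two orientations of each edge. *)
Lemma minor_model_of_linked_sets (V : finType) (e : rel V) (G : sgraph)
  (root : G -> V) (B : G -> {set V}) (S : G -> G -> {set V}) :
  symmetric e ->
  (forall v, root v \in B v) ->
  (forall v x y, x \in B v -> y \in B v -> connect (induced_rel (B v) e) x y) ->
  (forall u v x, x \in B u -> x \in B v -> u = v) ->
  (forall u v x y, adj u v -> x \in S u v -> y \in S u v ->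
     connect (induced_rel (S u v) e) x y) ->
  (forall u v, adj u v -> exists2 x, x \in S u v & x \in B u) ->
  (forall u v, adj u v -> exists2 x, x \in S u v & x \in B v) ->
  (forall u v w x, adj u v -> x \in S u v -> x \in B w -> w = u \/ w = v) ->
  (forall u v u' v' x, adj u v -> adj u' v' -> x \in S u v -> x \in S u' v' ->
     [set u; v]%SET = [set u'; v']%SET) ->
  exists B', minor_model e root B'.
Proof.
move=> esym rB Bc Bd Sc Su Sv SB SS.
pose lt (u v : G) := enum_rank u < enum_rank v.
pose U u v := [set x in S u v :\: B v |
  [exists y in S u v :&: B u, connect (induced_rel (S u v :\: B v) e) x y]]%SET.
pose B' u := (B u :|: \bigcup_(v | adj u v && lt u v) U u v)%SET.
have subB u : B u \subset B' u by apply: finset.subsetUl.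
have subU u v : adj u v -> lt u v -> U u v \subset B' u.
  move=> uv l; apply: fintype.subset_trans (finset.subsetUr _ _).
  by apply: (finset.bigcup_sup v); rewrite uv l.
have neq (u v : G) : adj u v -> u != v.
  by move=> uv; apply: contraTneq uv => ->; rewrite adj_irrefl.
have rsub (A A' : {set V}) x y : A \subset A' -> connect (induced_rel A e) x y ->
    connect (induced_rel A' e) x y.
  move=> /fintype.subsetP sub; apply: connect_sub => a b /= /and3P[ab aA bA].
  by apply: connect1; rewrite /induced_rel /= ab !sub.
have Uin u v x y : adj u v -> y \in S u v -> y \in B u ->
    connect (induced_rel (S u v :\: B v) e) x y -> x \in S u v :\: B v.
  move=> uv yS yB /connectP[[|z p] /=]; last by case/andP => /and3P[].
  move=> _ <-; rewrite inE yS andbT; apply/negP => /(Bd _ _ _ yB) euv.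
  by have := neq _ _ uv; rewrite euv eqxx.
have Uclosed u v x y : adj u v -> y \in S u v -> y \in B u ->
    connect (induced_rel (S u v :\: B v) e) x y -> x \in U u v.
  move=> uv yS yB c; rewrite inE (Uin u v x y) //=.
  by apply/existsP; exists y; rewrite !inE yS yB.
exists B'; split.
- by move=> v; apply: (fintype.subsetP (subB v)).
- move=> u x; rewrite finset.in_setU => /orP[xB|].
    by apply: rsub (Bc u x (root u) xB (rB u)).
  case/finset.bigcupP => v /andP[uv l]; rewrite inE => /andP[xS /existsP[y]].
  rewrite finset.in_setI => /andP[/andP[yS yB] c].
  apply: (connect_trans (y := y)); last by apply: rsub (Bc u y (root u) yB (rB u)).
  suff : connect (induced_rel (U u v) e) x y by apply: rsub; apply: subU.
  case/connectP: c => p; elim: p x {xS} => [x _ ->|z p IH x ep lp].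
    exact: connect0.
  have xU : x \in U u v by apply: (Uclosed _ _ _ y) => //; apply/connectP; exists (z :: p).
  have zU : z \in U u v.
    apply: (Uclosed _ _ _ y) => //; apply/connectP; exists p => //.
    by case/andP: ep.
  case/andP: ep => /and3P[xz _ _] ep; apply: connect_trans (IH z ep lp).
  by apply: connect1; rewrite /induced_rel /= xz xU.
- have BU u v w x : adj v w -> lt v w -> x \in B u -> x \in U v w -> u = v.
    move=> vw l xB; rewrite inE => /andP[/finset.setDP[xS xnB] _].
    by case: (SB _ _ _ _ vw xS xB) => // uw; rewrite -uw xB in xnB.
  move=> u v x; rewrite !finset.in_setU.
  move=> /orP[xu|/finset.bigcupP[u' /andP[uu' lu] xu]]
    /orP[xv|/finset.bigcupP[v' /andP[vv' lv] xv]].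
  + exact: Bd xu xv.
  + exact: BU xu xv.
  + by symmetry; apply: BU xv xu.
  move: xu xv; rewrite !inE => /andP[/andP[_ xS] _] /andP[/andP[_ xS'] _].
  have := SS _ _ _ _ _ uu' vv' xS xS' => eq.
  have /set2P[//|uv'] : u \in [set v; v']%SET by rewrite -eq !inE eqxx.
  have /set2P[//|vu'] : v \in [set u; u']%SET by rewrite eq !inE eqxx.
  by move: lu lv; rewrite /lt -uv' -vu' => l1 l2; have := ltn_trans l1 l2; rewrite ltnn.
(* Along a path in [S u v] from [B u] to [B v], the first step that leaves [U u v] must enter [B v],
   because [U u v] absorbs any neighbour in [S u v] outside [B v]. *)
have oriented u v : adj u v -> lt u v -> exists x y, [/\ x \in B' u, y \in B' v & e x y].
  move=> uv l; have [x xS xu] := Su _ _ uv; have [y yS yv] := Sv _ _ uv.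
  have xU : x \in U u v by apply: (Uclosed _ _ _ x).
  have yU : y \notin U u v by rewrite inE inE yv.
  case/connectP: (Sc _ _ _ _ uv xS yS) => p; elim: p x {xS xu} xU => [x xU _ eyx|z p IH x xU].
    by rewrite eyx xU in yU.
  case/andP=> /and3P[xz xS zS] ep lp; case: (boolP (z \in U u v)) => zU; first exact: IH zU ep lp.
  exists x, z; split=> //; first by apply: (fintype.subsetP (subU _ _ uv l)).
  apply: (fintype.subsetP (subB v)); apply: contraNT zU => zv.
  move: xU; rewrite inE => /andP[xSB /existsP[y0 /andP[/finset.setIP[y0S y0u] c]]].
  apply: (Uclosed _ _ _ y0) => //; apply: connect_trans c; apply: connect1.
  by rewrite /induced_rel /= esym xz xSB inE zS zv.
move=> u v uv; case: (ssrnat.ltngtP (enum_rank u) (enum_rank v)) => [l|l|].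
- exact: oriented.
- have [x [y [xv yu xy]]] := oriented v u (etrans (adj_sym v u) uv) l.
  by exists y, x; rewrite esym.
- by move=> /val_inj/enum_rank_inj euv; move: (neq _ _ uv); rewrite euv eqxx.
Qed.

(** * The square grid *)

Definition cell (k : nat) : finType := ('I_k.+1 * 'I_k.+1)%type.

Definition grid_edge (k : nat) : finType :=
  ('I_k * 'I_k.+1 + 'I_k.+1 * 'I_k)%type.

Definition grid_src (k : nat) (e : grid_edge k) : cell k :=
  match e with
  | inl (i, j) => (widen_ord (leqnSn k) i, j)
  | inr (i, j) => (i, widen_ord (leqnSn k) j)
  end.

Definition grid_tgt (k : nat) (e : grid_edge k) : cell k :=
  match e with
  | inl (i, j) => (lift ord0 i, j)
  | inr (i, j) => (i, lift ord0 j)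
  end.

(* Faces of the grid of cells are the interior corners of the cells; all the
   corners on the boundary of the big square stand for the outer face. *)
Definition grid_face (k : nat) : finType := option ('I_k * 'I_k).

(** Lattice points have coordinates from 0 to k + 1 and are interior when both lie between 1 and k;
    hence the shift by one. *)
Definition corner (k i j : nat) : grid_face k :=
  match i, j with
  | i'.+1, j'.+1 =>
      match insub i' : option 'I_k, insub j' : option 'I_k with
      | Some a, Some b => Some (a, b)
      | _, _ => None
      end
  | _, _ => None
  end.

Definition grid_left (k : nat) (e : grid_edge k) : grid_face k :=
  match e with
  | inl (i, j) => corner k i.+1 j
  | inr (i, j) => corner k i j.+1
  end.

Definition grid_right (k : nat) (e : grid_edge k) : grid_face k :=
  match e with
  | inl (i, j) => corner k i.+1 j.+1
  | inr (i, j) => corner k i.+1 j.+1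
  end.

Lemma corner_outer k i j :
  (i == 0) || (k < i) || (j == 0) || (k < j) -> corner k i j = None.
Proof.
case: i j => [|i] [|j] //=; rewrite !ltnS orbF => /orP[] le.
  by rewrite insubF // ltnNge le.
by case: insub => //= a; rewrite insubF // ltnNge le.
Qed.

Lemma corner_inner k (a b : 'I_k) : corner k a.+1 b.+1 = Some (a, b).
Proof. by rewrite /= !valK. Qed.

(** On a line of cells, cell x meets the edges x - 1 and x, which contribute [g x] and [g x.+1]. At
    the two ends the missing edge would contribute [g 0] or [g k.+1], both false. *)
Lemma xor_incident (g : nat -> bool) k x : x <= k ->
  g 0 = false -> g k.+1 = false ->
  \big[addb/false]_(a < k) (((a == x :> nat) (+) (a.+1 == x)) && g a.+1)
    = g x (+) g x.+1.
Proof.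
move=> le g0 gk.
suff -> : \big[addb/false]_(a < k) (((a == x :> nat) (+) (a.+1 == x)) && g a.+1)
    = (x <= k) && g x (+) ((x < k) && g x.+1).
  by rewrite le; move: le; rewrite leq_eqVlt => /predU1P[->|->]; rewrite ?ltnn ?gk.
move: {le gk} k; elim=> [|k IH].
  by rewrite big_ord0; case: x => [|x]; rewrite ?g0.
rewrite big_ord_recr /= {}IH.
have [->|[lt|gt]] : x = k \/ (x < k \/ k < x) by lia.
- rewrite leqnn ltnn leqnSn ltnSn eqxx gtn_eqF //=;
  by case: (g k); case: (g k.+1).
- have [-> -> -> ->] : [/\ (x <= k.+1) = true, (x < k.+1) = true,
    (k == x) = false & (k.+1 == x) = false] by split; lia.
  by rewrite lt (ltnW lt) /= addbF.
have -> : (x < k.+1) = false by lia.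
have -> : (x < k) = false by lia.
have -> : (x <= k) = false by lia.
have -> : (k == x) = false by lia.
have -> : (x <= k.+1) = (k.+1 == x) by lia.
by case: eqP => [<-|_] //=; rewrite addbF.
Qed.

(** The edges at a cell cross its four sides, each adding the values of [chi] at the two corners of
    that side. Every corner lies on two sides, and a side on the border adds nothing as both its
    corners are the outer face. *)
Lemma grid_even k (chi : grid_face k -> bool) (v : cell k) :
  \big[addb/false]_e (((grid_src e == v) (+) (grid_tgt e == v)) &&
    (chi (grid_left e) (+) chi (grid_right e))) = false.
Proof.
case: v => x y.
have xk : x <= k by rewrite -ltnS.
have yk : y <= k by rewrite -ltnS.
pose c i j := chi (corner k i j).
pose gx i := c i y (+) c i y.+1; pose gy j := c x j (+) c x.+1 j.
have c0 i j : (i == 0) || (k < i) || (j == 0) || (k < j) -> c i j = chi None.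
  by move=> /corner_outer; rewrite /c => ->.
have pairE (I J : finType) (f : I * J -> bool) :
    \big[addb/false]_p f p = \big[addb/false]_i \big[addb/false]_j f (i, j).
  by rewrite pair_bigA; apply: eq_bigr => -[].
rewrite big_sumType /=.
have -> : \big[addb/false]_(e : 'I_k * 'I_k.+1)
   (((grid_src (inl e) == (x, y)) (+) (grid_tgt (inl e) == (x, y))) &&
    (chi (grid_left (inl e)) (+) chi (grid_right (inl e)))) = gx x (+) gx x.+1.
  rewrite -(xor_incident xk) /gx ?c0 ?addbb // ?leqnn ?orbT //.
  rewrite pairE /=.
  apply: eq_bigr => i _; rewrite (bigD1 y) //= big1 ?addbF => [|j ne].
    by rewrite !xpair_eqE eqxx !andbT -!val_eqE.
  by rewrite !xpair_eqE (negbTE ne) !andbF.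
have -> : \big[addb/false]_(e : 'I_k.+1 * 'I_k)
   (((grid_src (inr e) == (x, y)) (+) (grid_tgt (inr e) == (x, y))) &&
    (chi (grid_left (inr e)) (+) chi (grid_right (inr e)))) = gy y (+) gy y.+1.
  rewrite -(xor_incident yk) /gy ?c0 ?addbb // ?leqnn ?orbT //.
  rewrite pairE /=.
  rewrite exchange_big /=.
  apply: eq_bigr => i _; rewrite (bigD1 x) //= big1 ?addbF => [|j ne].
    by rewrite !xpair_eqE eqxx -!val_eqE.
  by rewrite !xpair_eqE (negbTE ne).
rewrite /gx /gy; case: (c x y) (c x y.+1) (c x.+1 y) (c x.+1 y.+1);
  by do 3!case.
Qed.

Lemma grid_step k (c c' : cell k) :
  (c.2 == c'.2) && (c.1.+1 == c'.1 :> nat) || (c.1 == c'.1) && (c.2.+1 == c'.2 :> nat) ->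
  edge_rel (@grid_src k) (@grid_tgt k) c c'.
Proof.
case: c c' => [i j] [i' j'] /= /orP[]/andP[/eqP <- /eqP e].
  have lt : i < k by rewrite -ltnS e ltn_ord.
  apply/existsP; exists (inl (Ordinal lt, j)).
  by rewrite /= !xpair_eqE !eqxx -!val_eqE /= -e !eqxx.
have lt : j < k by rewrite -ltnS e ltn_ord.
apply/existsP; exists (inr (i, Ordinal lt)).
by rewrite /= !xpair_eqE !eqxx -!val_eqE /= -e !eqxx.
Qed.

Lemma grid_map k :
  plane_map (@grid_src k) (@grid_tgt k) (@grid_left k) (@grid_right k).
Proof.
split.
- case=> -[i j]; rewrite /= xpair_eqE -!val_eqE /= /bump /= add1n.
    by rewrite ltn_eqF.
  by rewrite [X in _ && X]ltn_eqF // andbF.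
(* Equality holds: 2k(k + 1) + 2 = (k + 1)^2 + (k^2 + 1). *)
- by rewrite card_sum !card_prod card_option card_prod !card_ord; lia.
- exact: grid_even.
- move=> chi H.
  (* The edge [inl (a, j)] separates consecutive corners of a column, so each column leads to its
     corner at height 0, which is outer. *)
  suff all0 f : chi f = chi None by move=> f g; rewrite !all0.
  case: f => [[a b]|//]; rewrite -corner_inner.
  have : b.+1 <= k.+1 by rewrite ltnS ltnW.
  elim: {b} b.+1 => [//|j IH] le.
  by rewrite -IH ?(ltnW le) //; symmetry; apply: (H (inl (a, Ordinal le))).
move=> x y.
suff to0 z : connect (edge_rel (@grid_src k) (@grid_tgt k)) z (ord0, ord0).
  apply: connect_trans (to0 x) _.
  by rewrite (sym_connect_sym (@edge_rel_sym _ _ _ _)).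
case: z => -[i lti] [j ltj].
apply: (connect_trans (y := (ord0, Ordinal ltj))).
  elim: i lti => [|i IH] lti.
    by rewrite (_ : Ordinal lti = ord0) //; apply: val_inj.
  apply: connect_trans (IH (ltnW lti)); apply: connect1.
  by rewrite edge_rel_sym; apply: grid_step; rewrite /= !eqxx.
elim: j ltj => [|j IH] ltj.
  by rewrite (_ : Ordinal ltj = ord0) //; apply: val_inj.
apply: connect_trans (IH (ltnW ltj)); apply: connect1.
by rewrite edge_rel_sym; apply: grid_step; rewrite /= !eqxx orbT.
Qed.

(** * From arcs to cells *)

Local Open Scope classical_set_scope.
Local Open Scope ring_scope.

(** The shift by [M] starts the slots at the left end of [-M, M]. Slots are closed and share end
    points, so that cells are closed sets; the price is that a point may lie in several cells. *)
Definition in_slot (R : realType) (M d : R) (i : nat) (x : R) :=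
  i%:R * d <= x + M <= i.+1%:R * d.

Definition in_cell (R : realType) (M d : R) (k : nat) (c : cell k) (p : R * R) :=
  in_slot M d c.1 p.1 && in_slot M d c.2 p.2.

Definition cells_meeting (R : realType) (M d : R) (k : nat) (A : set (R * R)) :
    {set cell k} :=
  [set c | `[< exists p, A p /\ in_cell M d c p >]]%SET.

Lemma in_slot_neighbour (R : realType) (M d x : R) (i j : nat) : 0 < d ->
  in_slot M d i x -> in_slot M d j x -> (i <= j.+1)%N.
Proof.
move=> d0 /andP[ix _] /andP[_ xj]; have := le_trans ix xj.
by rewrite ler_pM2r // ler_nat.
Qed.

Lemma in_slot_exists (R : realType) (M d x : R) (k : nat) :
  0 <= x + M <= k.+1%:R * d -> exists i : 'I_k.+1, in_slot M d i x.
Proof.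
move=> /andP[x0 xk]; have ex : exists i : nat, x + M <= i.+1%:R * d by exists k.
case: (ex_minnP ex) => i xi imin; have ik : (i < k.+1)%N by rewrite ltnS imin.
exists (Ordinal ik); rewrite /in_slot /= xi andbT.
case: i {ik} xi imin => [|i] xi imin; first by rewrite mul0r.
by rewrite leNgt; apply/negP => /ltW/imin; rewrite ltnn.
Qed.

Lemma closed_in_cell (R : realType) (M d : R) k (c : cell k) :
  closed [set p : R * R | in_cell M d c p].
Proof.
have closed_slot (i : nat) : closed [set x : R | in_slot M d i x].
  have -> : [set x : R | in_slot M d i x] =
      [set x | i%:R * d - M <= x] `&` [set x | x <= i.+1%:R * d - M].
    apply/seteqP; split=> x /=; rewrite /in_slot lerBlDr lerBrDr.
      by move/andP.
    by case=> -> ->.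
  by apply: closedI; [exact: closed_ge|exact: closed_le].
have -> : [set p : R * R | in_cell M d c p] =
    (fst @^-1` [set x | in_slot M d c.1 x]) `&` (snd @^-1` [set x | in_slot M d c.2 x]).
  by apply/seteqP; split=> p /=; [move/andP|case=> p1 p2; apply/andP].
apply: closedI; apply: preimage_closed => //.
- by move=> p _; exact: cvg_fst.
- by move=> p _; exact: cvg_snd.
Qed.

(* The cells through a point of A are linked with each other, and a point of
   A cannot be isolated from the rest of A by two disjoint closed sets. *)
Lemma cells_meeting_connected (R : realType) (M d : R) k (A : set (R * R)) c c' :
  0 < d -> (forall p, A p -> exists c : cell k, in_cell M d c p) -> connected A ->
  c \in cells_meeting M d k A -> c' \in cells_meeting M d k A ->
  connect (induced_rel (cells_meeting M d k A)
            (edge_rel (@grid_src k) (@grid_tgt k))) c c'.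
Proof.
move=> d0 cover conA cA c'A; set e := induced_rel _ _.
have inA p a : A p -> in_cell M d a p -> a \in cells_meeting M d k A.
  by move=> Ap ap; rewrite inE; apply/asboolP; exists p.
have csym : connect_sym e.
  by apply: sym_connect_sym; apply: induced_rel_sym; apply: edge_rel_sym.
have e1 a b : a \in cells_meeting M d k A -> b \in cells_meeting M d k A ->
    (a == b) || edge_rel (@grid_src k) (@grid_tgt k) a b -> connect e a b.
  move=> aA bA /predU1P[->|ab]; first exact: connect0.
  by apply: connect1; rewrite /e /induced_rel /= ab aA.
have succ (i j : nat) : (i < j)%N -> (j <= i.+1)%N -> i.+1 == j by lia.
(* Two cells through [p] may touch only diagonally. The cell [(a.1, b.2)] also contains [p] and is
   equal or adjacent to both. *)
have common p a b : A p -> in_cell M d a p -> in_cell M d b p -> connect e a b.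
  move=> Ap ap bp; have [[a1 a2] [b1 b2]] := (andP ap, andP bp).
  have mp : in_cell M d (a.1, b.2) p by apply/andP.
  apply: (connect_trans (y := (a.1, b.2))); apply: e1; try exact: inA mp.
  - exact: inA ap.
  - have := in_slot_neighbour d0 a2 b2; have := in_slot_neighbour d0 b2 a2.
    case: a {ap a1 a2 mp} => a1 a2 /= le1 le2.
    case: (ssrnat.ltngtP a2 b.2) => [lt|lt|/val_inj ->]; last by rewrite eqxx.
      rewrite [X in _ || X]grid_step ?orbT //= eqxx /=.
      by apply/orP; right; apply: succ.
    rewrite edge_rel_sym [X in _ || X]grid_step ?orbT //= eqxx /=.
    by apply/orP; right; apply: succ.
  - exact: inA bp.
  have := in_slot_neighbour d0 a1 b1; have := in_slot_neighbour d0 b1 a1.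
  case: b {bp b1 b2 mp} => b1 b2 /= le1 le2.
  case: (ssrnat.ltngtP a.1 b1) => [lt|lt|/val_inj ->]; last by rewrite eqxx.
    rewrite [X in _ || X]grid_step ?orbT //= eqxx /=.
    by apply/orP; left; apply: succ.
  rewrite edge_rel_sym [X in _ || X]grid_step ?orbT //= eqxx /=.
  by apply/orP; left; apply: succ.
pose W (b : bool) := [set p | exists2 a, connect e c a == b & in_cell M d a p].
have Wclosed b : closed (W b).
  rewrite (_ : W b = \bigcup_(a in [set a | connect e c a == b])
    [set p | in_cell M d a p]).
    by apply: closed_bigcup => [|a _]; [exact: finite_finset|exact: closed_in_cell].
  by apply/seteqP; split=> p /=.
have AW : A `&` W true = A.
  apply: conA.
  - move: (cA); rewrite inE => /asboolP[p [Ap cp]]; exists p; split=> //.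
    by exists c => //; rewrite connect0.
  - exists (~` W false); first exact: closed_openC.
    apply/seteqP; split=> p /= [Ap].
      move=> [a /eqP ca ap]; split=> // -[b /eqP cb bp].
      by have := connect_trans ca (common p a b Ap ap bp); rewrite cb.
    move=> nW; split=> //; have [a ap] := cover p Ap; exists a => //.
    by apply/eqP/negPn/negP => nca; apply: nW; exists a => //; exact/eqP/negbTE.
  - by exists (W true).
move: c'A; rewrite inE => /asboolP[p [Ap c'p]].
have [_ [a /eqP ca ap]] : (A `&` W true) p by rewrite AW.
exact: connect_trans ca (common p _ _ Ap ap c'p).
Qed.

(** The images of the three thirds of [0, 1]. The outer thirds will belong to the end vertices; the
    middle one then links them while staying away from both vertices. *)
Lemma arc_thirds (R : realType) (A : set (R * R)) (x y : R * R) :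
  is_arc A x y -> exists P Q M : set (R * R),
  [/\ [/\ compact P, compact Q & compact M],
      [/\ connected P, connected Q & connected M],
      [/\ P `<=` A, Q `<=` A & M `<=` A],
      [/\ P x, Q y, ~ Q x, ~ P y & ~ M x /\ ~ M y] &
      [/\ P `&` Q = set0, P `&` M !=set0 & Q `&` M !=set0]].
Proof.
case=> f [fc finj f0 f1 fA].
have sub (a b : R) : 0 <= a -> b <= 1 -> `[a, b] `<=` `[0, 1].
  by move=> a0 b1 t /=; rewrite !in_itv /= => /andP[at_ tb]; apply/andP; split; lra.
have fsub (a b : R) : 0 <= a -> b <= 1 -> [/\ compact (f @` `[a, b]),
    connected (f @` `[a, b]) & f @` `[a, b] `<=` A].
  move=> a0 b1; have fc' := continuous_subspaceW (sub a b a0 b1) fc.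
  split.
  - exact: continuous_compact fc' (@segment_compact _ _ _).
  - by apply: connected_continuous_connected fc'; exact: segment_connected.
  - by rewrite -fA; apply: image_subset; exact: sub.
have finj' (s t : R) : 0 <= s <= 1 -> 0 <= t <= 1 -> f s = f t -> s = t.
  by move=> s01 t01; apply: finj; rewrite ?inE /= ?in_itv.
have [||P1 P2 P3] := fsub 0 (1/3); [lra|lra|].
have [||Q1 Q2 Q3] := fsub (2/3) 1; [lra|lra|].
have [||M1 M2 M3] := fsub (1/3) (2/3); [lra|lra|].
have outside (a b t : R) : 0 <= a -> b <= 1 -> 0 <= t <= 1 -> ~ (a <= t <= b) ->
    ~ (f @` `[a, b]) (f t).
  move=> a0 b1 t01 nt [s]; rewrite /= in_itv /= => sab /finj' st.
  by apply: nt; rewrite -st //; move/andP: sab => [? ?]; apply/andP; split; lra.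
have inside (a b t : R) : a <= t <= b -> (f @` `[a, b]) (f t).
  by move=> tab; exists t => //=; rewrite in_itv.
exists (f @` `[0, 1/3]), (f @` `[2/3, 1]), (f @` `[1/3, 2/3]); split=> //.
- rewrite -f0 -f1; split; try split.
  + by apply: inside; lra.
  + by apply: inside; lra.
  + by apply: outside; lra.
  + by apply: outside; lra.
  + by apply: outside; lra.
  + by apply: outside; lra.
- split.
  + rewrite -subset0 => _ [[s sI <-] Q]; move: Q; rewrite /= in_itv /= in sI.
    by apply: outside; lra.
  + by exists (f (1/3)); split; apply: inside; lra.
  + by exists (f (2/3)); split; apply: inside; lra.
Qed.

(** Each pair in the compact product has some r separating it; a third of r is spent on moving
    either point and a third on the radius. The form with [\near] lets finitely many pairs of sets
    share one radius. *)
Lemma compact_separation (R : realType) (A B : set (R * R)) :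
  compact A -> compact B -> A `&` B = set0 ->
  \forall e \near 0^'+, forall p q, A p -> B q -> ~ ball p e q.
Proof.
move=> cA cB AB0.
have [+ _] := compact_near_coveringP (A `*` B).
move=> /(_ (compact_setX cA cB)) cov.
have := cov R 0^'+ (fun e x => ~ ball x.1 e x.2) _.
suff loc : forall x, (A `*` B) x -> \forall x' \near x & e \near 0^'+,
    ~ ball x'.1 e x'.2.
  by move=> /(_ _ loc); apply: filterS => e He p q Ap Bq; exact: (He (p, q)).
case=> p q [/= Ap Bq].
have [r r0 pqr] : exists2 r : R, 0 < r & ~ ball p r q.
  apply: contrapT => nr; suff pq : p = q.
    by move: AB0; rewrite -subset0 => /(_ p); apply; split=> //; rewrite pq.
  have closeR (x y : R) : (forall r, 0 < r -> `|x - y| < r) -> x = y.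
    move=> H; apply/eqP; rewrite -subr_eq0 -normr_eq0 eq_le normr_ge0 andbT.
    by apply/ler_addgt0Pr => r r0; rewrite add0r ltW // H.
  have H r : 0 < r -> ball p r q by move=> r0; apply: contrapT => n; apply: nr; exists r.
  case: p q {Ap Bq AB0 nr} H => [p1 p2] [q1 q2] H.
  by congr (_, _); apply: closeR => r /H[].
have r3 : 0 < r / 3 by rewrite divr_gt0.
exists (ball (p, q) (r / 3), [set e | e < r / 3]) => /=.
  split; first exact: nbhsx_ballx.
  exact: nbhs_right_lt.
move=> [[p' q'] e] /= [[pp' qq'] er] p'q'; apply: pqr.
have -> : r = r / 3 + r / 3 + r / 3 by field.
apply: ball_triangle (ball_sym qq').
by apply: ball_triangle pp' _; exact: le_ball (ltW er) _ p'q'.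
Qed.

Lemma compact_box (R : realType) (A : set (R * R)) : compact A ->
  \forall M \near +oo, forall p, A p -> `|p.1| <= M /\ `|p.2| <= M.
Proof.
move=> cA.
have bounded (f : R * R -> R) : continuous f ->
    \forall M \near +oo, forall p, A p -> `|f p| <= M.
  move=> cf; have : compact (f @` A).
    by apply: continuous_compact (continuous_subspaceT (A:=A) cf) cA.
  move=> /(@compact_bounded R R^o) bd; rewrite /bounded_set /bounded_near in bd.
  by apply: filterS bd => M HM p Ap; apply: HM; exists p.
have b1 : \forall M \near +oo, forall p, A p -> `|p.1| <= M.
  by apply: (bounded fst) => x; exact: cvg_fst.
have b2 : \forall M \near +oo, forall p, A p -> `|p.2| <= M.
  by apply: (bounded snd) => x; exact: cvg_snd.
by apply: filterS2 b1 b2 => M H1 H2 p Ap; split; [exact: H1|exact: H2].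
Qed.

(* The arc of each edge is cut into thirds.  K v is the star of the thirds at
   v, and S u v is the middle third of the edge uv. *)
Lemma drawing_linked_compacta (R : realType) (G : sgraph) : planar R G ->
  exists (K : G -> set (R * R)) (S : G -> G -> set (R * R)),
  [/\ forall v, [/\ compact (K v), connected (K v) & K v !=set0],
      forall u v, adj u v -> compact (S u v) /\ connected (S u v),
      forall u v, u <> v -> K u `&` K v = set0,
      forall u v, adj u v -> S u v `&` K u !=set0 /\ S u v `&` K v !=set0 &
      (forall u v w, adj u v -> w <> u -> w <> v -> S u v `&` K w = set0) /\
      (forall u v u' v', adj u v -> adj u' v' ->
         [set u; v]%SET <> [set u'; v']%SET -> S u v `&` S u' v' = set0)].
Proof.
case=> pos [arc [posinj arcP vertexP disjP]].
have edgeG u v : adj u v -> [set u; v]%SET \in edges G.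
  by move=> uv; apply/edgesP; exists u, v.
have neq (u v : G) : adj u v -> u <> v.
  by move=> + uv; rewrite uv adj_irrefl.
have pos_arc u v w : adj u v -> arc [set u; v]%SET (pos w) -> w = u \/ w = v.
  by move=> uv /(vertexP _ (edgeG _ _ uv)) /set2P.
have meet u v u' v' p : adj u v -> adj u' v' ->
    [set u; v]%SET <> [set u'; v']%SET ->
    arc [set u; v]%SET p -> arc [set u'; v']%SET p ->
    exists w, [/\ p = pos w, w = u \/ w = v & w = u' \/ w = v'].
  move=> uv uv' /eqP ne p1 p2.
  have [|w [/set2P wu /set2P wv] <-] := disjP _ _ (edgeG _ _ uv) (edgeG _ _ uv') ne p.
    by [].
  by exists w.
have /choice[h hP] : forall e : G * G, exists t : set (R * R) * set (R * R) * set (R * R),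
    adj e.1 e.2 -> let: (P, Q, M) := t in let A := arc [set e.1; e.2]%SET in
    [/\ [/\ compact P, compact Q & compact M],
      [/\ connected P, connected Q & connected M],
      [/\ P `<=` A, Q `<=` A & M `<=` A],
      [/\ P (pos e.1), Q (pos e.2), ~ Q (pos e.1), ~ P (pos e.2) &
        ~ M (pos e.1) /\ ~ M (pos e.2)] &
      [/\ P `&` Q = set0, P `&` M !=set0 & Q `&` M !=set0]].
  move=> e; case: (boolP (adj e.1 e.2)) => [/arcP/arc_thirds[P [Q [M H]]]|_].
    by exists (P, Q, M).
  by exists (set0, set0, set0).
(* [T u v] is the third of the edge uv at [u]. Both orientations must use the same cutting of the
   arc, so the enumeration of the vertices selects one. *)
pose T u v := if (enum_rank u < enum_rank v)%N then (h (u, v)).1.1 else (h (v, u)).1.2.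
pose M u v := if (enum_rank u < enum_rank v)%N then (h (u, v)).2 else (h (v, u)).2.
have thirds u v : adj u v ->
  [/\ [/\ compact (T u v), connected (T u v) & T u v `<=` arc [set u; v]%SET],
      [/\ compact (M u v), connected (M u v) & M u v `<=` arc [set u; v]%SET],
      T u v (pos u) /\ ~ T u v (pos v),
      ~ M u v (pos u) /\ ~ M u v (pos v) &
      [/\ T u v `&` T v u = set0, T u v `&` M u v !=set0 & T v u `&` M u v !=set0]].
  move=> uv; have vu : adj v u by rewrite adj_sym.
  have := hP (u, v) uv; have := hP (v, u) vu; rewrite /T /M /=.
  case: (ssrnat.ltngtP (enum_rank u) (enum_rank v)) => [_ _|_ + _|/val_inj/enum_rank_inj/neq//].
    case: (h (u, v)) => [[P Q] N] /= [[? ? ?] [? ? ?] [? ? ?] [? ? ? ? [? ?]] [? ? ?]].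
    by [].
  rewrite (finset.setUC [set v]%SET).
  case: (h (v, u)) => [[P Q] N] /= [[? ? ?] [? ? ?] [? ? ?] [? ? ? ? [? ?]] [PQ ? ?]].
  by rewrite (setIC Q).
have T_own u v w : adj u v -> T u v (pos w) -> w = u.
  move=> uv Tw; have [[_ _ sub] _ [_ nv] _ _] := thirds u v uv.
  by case: (pos_arc _ _ _ uv (sub _ Tw)) => // wv; case: nv; move: Tw; rewrite wv.
have T_disj u w v w' : adj u w -> adj v w' -> u <> v -> T u w `&` T v w' = set0.
  move=> uw vw' uv; rewrite -subset0 => p [Tp T'p].
  have [[_ _ sub] _ _ _ [dis _ _]] := thirds _ _ uw.
  have [[_ _ sub'] _ _ _ _] := thirds _ _ vw'.
  case: (eqVneq [set u; w]%SET [set v; w']%SET) => [eq|/eqP ne].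
    have /set2P[//|uw'] : u \in [set v; w']%SET by rewrite -eq !inE eqxx.
    have /set2P[/esym//|vw] : v \in [set u; w]%SET by rewrite eq !inE eqxx.
    by rewrite -dis; split; rewrite // uw' vw in Tp T'p *.
  have [z [pz _ _]] := meet _ _ _ _ _ uw vw' ne (sub _ Tp) (sub' _ T'p).
  by rewrite pz in Tp T'p; apply: uv; rewrite -(T_own _ _ _ uw Tp) (T_own _ _ _ vw' T'p).
(* The singleton for non-neighbours keeps [K v] nonempty at an isolated vertex and changes nothing
   elsewhere. *)
pose C v w := if adj v w then T v w else [set pos v].
pose K v := \bigcup_(w in [set` predT]) C v w.
have C_pos v w : C v w (pos v).
  by rewrite /C; case: ifP => // /thirds[_ _ []].
have KT u v : adj u v -> T u v `<=` K u.
  by move=> uv p Tp; exists v => //; rewrite /C uv.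
have K_inv v p : K v p -> p = pos v \/ exists2 w, adj v w & T v w p.
  by case=> w _; rewrite /C; case: ifP => [vw Tp|_ ->]; [right; exists w|left].
have S_meet u v u' v' p : adj u v -> adj u' v' ->
    [set u; v]%SET <> [set u'; v']%SET -> M u v p -> ~ arc [set u'; v']%SET p.
  move=> uv uv' ne Mp arcp; have [_ [_ _ sub] _ [nu nv] _] := thirds u v uv.
  have [w [pw [wu|wv] _]] := meet _ _ _ _ _ uv uv' ne (sub _ Mp) arcp.
    by apply: nu; rewrite pw wu in Mp.
  by apply: nv; rewrite pw wv in Mp.
exists K, M; split.
- move=> v; split.
  + rewrite /K bigcup_pred; apply: bigsetU_compact => w _; rewrite /C.
    by case: ifP => [/thirds[[]]//|_]; exact: compact_set1.
  + apply: bigcup_connected; first by exists (pos v) => w _; exact: C_pos.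
    move=> w _; rewrite /C; case: ifP => [/thirds[[]]//|_]; exact: connected1.
  + by exists (pos v), v.
- by move=> u v /thirds[_ []].
- move=> u v uv; rewrite -subset0 => p [/K_inv[pu|[w uw Tp]] /K_inv[pv|[w' vw' Tp']]].
  + by apply: uv; apply: posinj; rewrite -pu.
  + by rewrite pu in Tp'; apply: uv; exact: T_own vw' Tp'.
  + by rewrite pv in Tp; apply: uv; symmetry; exact: T_own uw Tp.
  + by rewrite -(T_disj _ _ _ _ uw vw' uv).
- move=> u v uv; have [_ _ _ _ [_ [p [p1 p2]] [q [q1 q2]]]] := thirds _ _ uv.
  split; first by exists p; split=> //; exact: KT p1.
  by exists q; split=> //; apply: KT q1; rewrite adj_sym.
split=> [u v w uv wu wv|u v u' v' uv uv' ne].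
  rewrite -subset0 => p [Mp /K_inv[pw|[x wx Tp]]].
    have [_ [_ _ sub] _ _ _] := thirds _ _ uv; rewrite pw in Mp.
    by case: (pos_arc _ _ _ uv (sub _ Mp)).
  have [[_ _ sub] _ _ _ _] := thirds _ _ wx.
  apply: (S_meet _ _ _ _ _ uv wx _ Mp (sub _ Tp)) => eq.
  by have /set2P[] : w \in [set u; v]%SET by rewrite eq !inE eqxx.
rewrite -subset0 => p [Mp Mp']; have [_ [_ _ sub] _ _ _] := thirds _ _ uv'.
exact: (S_meet _ _ _ _ _ uv uv' ne Mp (sub _ Mp')).
Qed.

Lemma planar_sparse (R : realType) (G : sgraph) (v0 : G) :
  planar R G -> girth_gt9 G -> (4 * #|edges G| < 5 * #|G|)%N.
Proof.
move=> /drawing_linked_compacta[K [S [KP SP Kdis SK [SKdis SSdis]]]] girthG.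
(* All pieces form one finite family, so a single distance [e] and a single box [M] serve for all of
   them. *)
pose C (i : G + G * G) := match i with
  | inl v => K v
  | inr (u, v) => if adj u v then S u v else set0
  end.
have Ccompact i : compact (C i).
  case: i => [v|[u v]] /=; first by have [] := KP v.
  by case: ifP => [/SP[]//|_]; exact: compact0.
have [e e0 He] : exists2 e : R, 0 < e & forall i j, C i `&` C j = set0 ->
    forall p q, C i p -> C j q -> ~ ball p e q.
  pose sep (ij : (G + G * G) * (G + G * G)) (e : R) := C ij.1 `&` C ij.2 = set0 ->
    forall p q, C ij.1 p -> C ij.2 q -> ~ ball p e q.
  have : \forall e \near (0 : R)^'+, 0 < e /\ forall ij, sep ij e.
    apply: filterI; first exact: nbhs_right_gt.
    apply: (@filter_forall _ _ sep _ (at_right_proper_filter 0)) => ij.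
    have [dis|nd] := pselect (C ij.1 `&` C ij.2 = set0).
      by apply: filterS (compact_separation (Ccompact ij.1) (Ccompact ij.2) dis) => e He _.
    by apply: nearW => e /nd.
  by move=> /filter_ex[e [e0 H]]; exists e => // i j; exact: (H (i, j)).
have [M M0 HM] : exists2 M : R, 0 < M & forall i p, C i p ->
    `|p.1| <= M /\ `|p.2| <= M.
  pose box i (M : R) := forall p, C i p -> `|p.1| <= M /\ `|p.2| <= M.
  have : \forall M \near +oo, 0 < M /\ forall i, box i M.
    apply: (filterI (nbhs_pinfty_gt _)); first by [].
    have FF : Filter (nbhs (pinfty_nbhs R)) by exact: proper_pinfty_nbhs.
    by apply: (filter_forall FF) => i; exact: compact_box.
  by move=> /filter_ex[M [M0 H]]; exists M.
(* The square [-M, M]^2 is cut into (k + 1)^2 cells of side [d] < [e]; two points of one cell are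
   then closer than any two disjoint pieces can be. *)
pose k := Num.truncn (2 * M / e); pose d := 2 * M / k.+1%:R.
have k0 : 0 < k.+1%:R :> R by rewrite ltr0n.
have d0 : 0 < d by rewrite divr_gt0 // mulr_gt0.
have dk : k.+1%:R * d = 2 * M by rewrite mulrC divfK // gt_eqF.
have de : d < e.
  by rewrite ltr_pdivrMr // -ltr_pdivrMl // mulrC truncnS_gt.
have cover i p : C i p -> exists c : cell k, in_cell M d c p.
  move=> /HM[]; rewrite !ler_norml => /andP[l1 u1] /andP[l2 u2].
  have [|a ap] := @in_slot_exists R M d p.1 k; first by rewrite dk; apply/andP; split; lra.
  have [|b bp] := @in_slot_exists R M d p.2 k; first by rewrite dk; apply/andP; split; lra.
  by exists (a, b); apply/andP.
have disjoint i j c : C i `&` C j = set0 -> c \in cells_meeting M d k (C i) ->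
    c \in cells_meeting M d k (C j) -> False.
  move=> dis; rewrite inE => /asboolP[p [Cp cp]].
  rewrite inE => /asboolP[q [Cq cq]].
  apply: (He _ _ dis p q Cp Cq).
  have slot_close (a : nat) (x y : R) : in_slot M d a x -> in_slot M d a y -> `|x - y| < e.
    move=> /andP[x1 x2] /andP[y1 y2]; apply: le_lt_trans de.
    have ad : a.+1%:R * d = a%:R * d + d by rewrite -natr1 mulrDl mul1r.
    by rewrite ler_norml; apply/andP; split; lra.
  have [[c1 c2] [c3 c4]] := (andP cp, andP cq).
  by split; [exact: slot_close c1 c3|exact: slot_close c2 c4].
have meet A B p : A p -> B p -> (exists i, C i p) -> exists2 c,
    c \in cells_meeting M d k A & c \in cells_meeting M d k B.
  move=> Ap Bp [i /cover[c cp]]; exists c; rewrite inE; apply/asboolP; by exists p.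
have conn i : connected (C i) -> forall x y, x \in cells_meeting M d k (C i) ->
    y \in cells_meeting M d k (C i) ->
    connect (induced_rel (cells_meeting M d k (C i))
               (edge_rel (@grid_src k) (@grid_tgt k))) x y.
  by move=> co x y; apply: cells_meeting_connected => //; exact: cover.
have /choice[root rootP] : forall v, exists c, c \in cells_meeting M d k (K v).
  move=> v; have [_ _ [p Kp]] := KP v.
  by have [c] := meet _ _ p Kp Kp (ex_intro _ (inl v) Kp); exists c.
have CS u v : adj u v -> C (inr (u, v)) = S u v by move=> /= ->.
have [||||||||| B' mm] := @minor_model_of_linked_sets (cell k)
  (edge_rel (@grid_src k) (@grid_tgt k)) G root
  (fun v => cells_meeting M d k (K v)) (fun u v => cells_meeting M d k (S u v)).
- exact: edge_rel_sym.
- exact: rootP.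
- by move=> v; apply: (conn (inl v)); have [] := KP v.
- move=> u v x xu xv; apply: contrapT => uv.
  exact: (disjoint (inl u) (inl v) x (Kdis _ _ uv)).
- by move=> u v x y uv; rewrite -CS //; apply: conn; rewrite CS //; have [] := SP u v uv.
- move=> u v uv; have [[p [Sp Kp]] _] := SK u v uv.
  exact: (meet _ _ p Sp Kp (ex_intro _ (inl u) Kp)).
- move=> u v uv; have [_ [p [Sp Kp]]] := SK u v uv.
  exact: (meet _ _ p Sp Kp (ex_intro _ (inl v) Kp)).
- move=> u v w x uv xS xK; apply: contrapT => /not_orP[wu wv].
  apply: (disjoint (inr (u, v)) (inl w) x) => //; rewrite CS //.
  by apply: SKdis.
- move=> u v u' v' x uv uv' xS xS'; apply: contrapT => ne.
  apply: (disjoint (inr (u, v)) (inr (u', v')) x); rewrite !CS //.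
  exact: SSdis.
apply: (minor_sparse v0 (@grid_map k) mm) => b bG b0 even.
exact: even_subgraph_size girthG bG b0 even.
Qed.

(** * Colour sets and reducible configurations *)

Local Close Scope classical_set_scope.
Local Close Scope ring_scope.
Local Open Scope nat_scope.

Definition compat (lb : edge_label) (a b : nat) : bool :=
  let near := (a <= b + 2) && (b <= a + 2) in if lb is Near then near else ~~ near.

Lemma compat_sym lb a b : compat lb a b = compat lb b a.
Proof. by rewrite /compat andbC. Qed.

Definition colors : seq nat := iota 1 8.

(* Families of colour sets.  Whatever colours lie outside a branch hanging at
   a vertex u, the colours of u that extend to the branch contain some member
   of the family of the branch. *)
Definition reach (lb : edge_label) (F : seq nat) : seq nat :=
  [seq a <- colors | has (compat lb a) F].

Definition fam_step (fam : seq (seq nat)) : seq (seq nat) :=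
  undup [seq reach lb F | lb <- [:: Near; Far], F <- fam].

Definition fam_meet (fam fam' : seq (seq nat)) : seq (seq nat) :=
  undup [seq [seq a <- F | a \in F'] | F <- fam, F' <- fam'].

(** A coloured vertex has one unknown colour, hence the singletons; each step then crosses one edge
    of unknown label. *)
Definition fam0 := fam_step [seq [:: a] | a <- colors].
Definition fam1 := fam_step fam0.
Definition fam2 := fam_step fam1.
Definition fam_bad := fam_step (fam_meet fam1 fam2).

(* Kinds 0, 1, 2: a coloured neighbour, or the start of a thread of one or two
   vertices of degree 2; kind 3 (bad): a neighbour of degree 3 that carries, away
   from its parent, a thread of one and a thread of two such vertices. *)
Definition kind_fam (k : nat) : seq (seq nat) := nth fam_bad [:: fam0; fam1; fam2] k.

Fixpoint always_meet (fams : seq (seq (seq nat))) (F : seq nat) : bool :=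
  if fams is fam :: fams' then
    all (fun F' => always_meet fams' [seq a <- F | a \in F']) fam
  else F != [::].

Lemma always_meetP (T : eqType) (fam : T -> seq (seq nat)) (Y : seq T) F :
  always_meet [seq fam y | y <- Y] F ->
  forall Fs : T -> seq nat, {in Y, forall y, Fs y \in fam y} ->
  exists2 a, a \in F & {in Y, forall y, a \in Fs y}.
Proof.
elim: Y F => [|y Y IH] F /=.
  by case: F => [//|a F] _ Fs _; exists a; rewrite ?inE ?eqxx.
move=> /allP H Fs HF.
have [|a] := IH _ (H _ (HF y (mem_head _ _))) Fs.
  by move=> z zY; apply: HF; rewrite inE zY orbT.
rewrite mem_filter => /andP[ay aF] aY; exists a => // z.
by rewrite inE => /predU1P[->|/aY].
Qed.

(** The charge owed to a branch: one per vertex of degree 2 on a thread, and one to a bad neighbour,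
    whose own charge 4 * 3 - 10 = 2 is one short of the 1 + 2 that it owes to its threads. *)
Definition kind_weight (k : nat) : nat := if k == 3 then 1 else k.

Definition kinds : seq nat := iota 0 4.

Definition reducible (ks : seq nat) : bool :=
  always_meet [seq kind_fam k | k <- ks] colors.

Lemma reducible1 k : k \in kinds -> reducible [:: k].
Proof. by move: k; apply/allP; vm_compute. Qed.

(** Excludes three consecutive vertices of degree 2. *)
Lemma reducible2 k1 k2 : k1 \in [:: 1; 2] -> k2 \in [:: 1; 2] ->
  reducible [:: k1; k2].
Proof.
move=> H1 H2; suff /allP/(_ _ H1)/allP/(_ _ H2) : all (fun k1 => all (fun k2 =>
  reducible [:: k1; k2]) [:: 1; 2]) [:: 1; 2] by [].
by vm_compute.
Qed.

(** The threshold 2 = 4 * 3 - 10 is the charge of a vertex of degree 3. The pattern set aside is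
    that of a bad vertex. *)
Lemma reducible3 k1 k2 k3 : k1 \in kinds -> k2 \in kinds -> k3 \in kinds ->
  2 < kind_weight k1 + kind_weight k2 + kind_weight k3 ->
  ~~ perm_eq [:: 0; 1; 2] [:: k1; k2; k3] -> reducible [:: k1; k2; k3].
Proof.
move=> H1 H2 H3 lt ne; suff /allP/(_ _ H1)/allP/(_ _ H2)/allP/(_ _ H3) :
  all (fun k1 => all (fun k2 => all (fun k3 =>
    if 2 < kind_weight k1 + kind_weight k2 + kind_weight k3 then
      if perm_eq [:: 0; 1; 2] [:: k1; k2; k3] then true
      else reducible [:: k1; k2; k3]
    else true) kinds) kinds) kinds by rewrite lt (negbTE ne).
by vm_compute.
Qed.

(** The threshold 6 = 4 * 4 - 10 is the charge of a vertex of degree 4. *)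
Lemma reducible4 k1 k2 k3 k4 :
  k1 \in kinds -> k2 \in kinds -> k3 \in kinds -> k4 \in kinds ->
  6 < kind_weight k1 + kind_weight k2 + kind_weight k3 + kind_weight k4 ->
  reducible [:: k1; k2; k3; k4].
Proof.
move=> H1 H2 H3 H4 lt.
suff /allP/(_ _ H1)/allP/(_ _ H2)/allP/(_ _ H3)/allP/(_ _ H4) :
  all (fun k1 => all (fun k2 => all (fun k3 => all (fun k4 =>
    if 6 < kind_weight k1 + kind_weight k2 + kind_weight k3 + kind_weight k4
    then reducible [:: k1; k2; k3; k4] else true) kinds) kinds) kinds) kinds.
  by rewrite lt.
by vm_compute.
Qed.

(** The ends of walks without backtracking that start with the edge from [u] to [x] and have at most
    [k] edges; [u] is the vertex just left. *)
Fixpoint ball_from (G : sgraph) (k : nat) (u x : G) : {set G} :=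
  if k is k'.+1 then
    (x |: \bigcup_(y | adj x y && (y != u)) ball_from k' x y)%SET
  else finset.set0.

Lemma ball_from_mono (G : sgraph) k k' (u x : G) :
  k <= k' -> ball_from k u x \subset ball_from k' u x.
Proof.
elim: k k' u x => [|k IH] [|k'] u x //= le; first exact: finset.sub0set.
apply: finset.setUS; apply/fintype.subsetP => z /finset.bigcupP[y Py zy].
by apply/finset.bigcupP; exists y => //; apply: (fintype.subsetP (IH k' x y le)).
Qed.

Lemma ball_from_walk (G : sgraph) k (u x y : G) :
  adj u x -> y \in ball_from k u x ->
  exists (a : nat -> G) (n : nat), [/\ 0 < n <= k, a 0 = u, a 1 = x, a n = y &
    (forall i, i < n -> adj (a i) (a i.+1)) /\
    (forall i, i.+1 < n -> a i != a i.+2)].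
Proof.
elim: k u x => [|k IH] u x ux /=; first by rewrite inE.
rewrite finset.in_setU1 => /predU1P[->|/finset.bigcupP[z /andP[xz zu] yz]].
  exists (fun i => if i is 0 then u else x), 1; split=> //.
  by split=> [[]|[]].
have [a [n [/andP[n0 nk] a0 a1 an [aadj anb]]]] := IH x z xz yz.
exists (fun i => if i is j.+1 then a j else u), n.+1; split=> //.
split=> [[|i] //|[|i]]; rewrite ?ltnS ?a0 ?a1 //.
- exact: aadj.
- by rewrite eq_sym.
- exact: anb.
Qed.

(** As x and x' differ, a walk from [y] back to [u] followed by one from [u] to [z] does not
    backtrack. It has at most 8 edges, hence at most 9 with a closing edge between [z] and [y]. *)
Lemma ball_from_separated (G : sgraph) k k' (u x x' y z : G) :
  girth_gt9 G -> k + k' <= 8 -> adj u x -> adj u x' -> x != x' ->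
  y \in ball_from k u x -> z \in ball_from k' u x' -> y != z /\ ~~ adj y z.
Proof.
move=> girthG kk ux ux' xx' /(ball_from_walk ux)[a [n [/andP[n0 nk] a0 a1 an [aadj anb]]]].
move=> /(ball_from_walk ux')[b [m [/andP[m0 mk] b0 b1 bm [badj bnb]]]].
pose w i := if i <= n then a (n - i) else b (i - n).
have wa i : i <= n -> w i = a (n - i) by move=> le; rewrite /w le.
have wb i : w (n + i) = b i.
  rewrite /w; case: i => [|i]; first by rewrite addn0 leqnn subnn a0 b0.
  by rewrite ifN ?addKn // -ltnNge addnS ltnS leq_addr.
have wadj i : i < n + m -> adj (w i) (w i.+1).
  case: (ltnP i n) => lt le.
    rewrite !wa ?(ltnW lt) // adj_sym (_ : n - i = (n - i.+1).+1); last lia.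
    by apply: aadj; lia.
  rewrite (_ : i = n + (i - n)); last lia.
  by rewrite -addnS !wb; apply: badj; lia.
have wnb i : i.+1 < n + m -> w i != w i.+2.
  case: (ltnP i.+1 n) => lt le.
    rewrite !wa; [|lia|lia]; rewrite eq_sym (_ : n - i = (n - i.+2).+2); last lia.
    by apply: anb; lia.
  case: (ltnP i n) => lt'.
    rewrite wa; last lia; rewrite (_ : n - i = 1); last lia.
    rewrite (_ : i.+2 = n + 1); last lia.
    by rewrite wb a1 b1.
  rewrite (_ : i = n + (i - n)); last lia.
  by rewrite -!addnS !wb; apply: bnb; lia.
have w0 : w 0 = y by rewrite wa // subn0.
have wnm : w (n + m) = z by rewrite wb.
have dist d : 0 < d <= n + m -> y != w d.
  move=> /andP[d0 dnm]; rewrite -w0.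
  by apply: (@nonbacktracking_neq G w (n + m) d 0) => //; lia.
split; first by rewrite -wnm; apply: dist; lia.
apply/negP => yz.
(* [y] is appended after [z]. This does not backtrack, since by [dist] the vertex before [z] is not
   [y], and it returns to its start. *)
pose w' i := if i <= n + m then w i else y.
have : w' 0 != w' (0 + (n + m).+1).
  apply: (@nonbacktracking_neq G w' (n + m).+1) => //; first lia.
    move=> i; rewrite ltnS /w' => le; rewrite le.
    case: ltnP => // lt; first exact: wadj.
    by rewrite (_ : i = n + m) ?wnm 1?adj_sym //; lia.
  move=> i; rewrite ltnS /w' => lt; rewrite (ltnW lt).
  case: ltnP => // lt'; first exact: wnb.
  by rewrite eq_sym; apply: dist; lia.
by rewrite /w' add0n ltnn /= w0 eqxx.
Qed.

(** * Extension of colourings into branches *)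

Definition edge_ok (G : sgraph) (l : edge_labeling G) (c : G -> nat) (x y : G) : bool :=
  compat (l [set x; y]%SET) (c x) (c y).

Lemma edge_ok_sym (G : sgraph) (l : edge_labeling G) c x y :
  edge_ok l c x y = edge_ok l c y x.
Proof. by rewrite /edge_ok finset.setUC compat_sym. Qed.

Definition in_range (G : sgraph) (c : G -> nat) := forall v, c v \in colors.

(** The colour set [F] may depend on the colouring [c] outside, the region [B] may not. [c] need not
    respect any label: all edges meeting [B] are repaired, and [c] is kept away from [B] and [u]. *)
Definition branch (G : sgraph) (l : edge_labeling G) k (u x : G)
    (fam : seq (seq nat)) :=
  exists2 B : {set G}, B \subset ball_from k u x &
    forall c, in_range c -> exists2 F, F \in fam & forall a, a \in colors -> a \in F ->
      exists c', [/\ in_range c', c' u = a, forall z, z \notin B -> z != u -> c' z = c z,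
        edge_ok l c' u x & forall y z, y \in B -> adj y z -> edge_ok l c' y z].

(** The recolourings of the branches agree at [x], where all give the colour a, and their regions
    are disjoint and non-adjacent by [ball_from_separated], so they glue. *)
Lemma branches_extend (G : sgraph) (l : edge_labeling G) (x : G) (Y : {set G})
  (fam : G -> seq (seq nat)) (k : nat) :
  girth_gt9 G -> k <= 3 ->
  (forall y, y \in Y -> adj x y /\ branch l k x y (fam y)) ->
  exists2 U : {set G}, U \subset \bigcup_(y in Y) ball_from k x y &
    forall c, in_range c -> exists2 Fs : G -> seq nat,
      (forall y, y \in Y -> Fs y \in fam y) &
      forall a, a \in colors -> (forall y, y \in Y -> a \in Fs y) ->
        exists c', [/\ in_range c', c' x = a,
          forall z, z \notin U -> z != x -> c' z = c z,
          forall y, y \in Y -> edge_ok l c' x y &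
          forall y z, y \in U -> adj y z -> edge_ok l c' y z].
Proof.
move=> girthG k3 HY.
have /choice[B HB] : forall y, exists B : {set G}, y \in Y ->
    B \subset ball_from k x y /\
    forall c, in_range c -> exists2 F, F \in fam y & forall a, a \in colors -> a \in F ->
      exists c', [/\ in_range c', c' x = a, forall z, z \notin B -> z != x -> c' z = c z,
        edge_ok l c' x y & forall w z, w \in B -> adj w z -> edge_ok l c' w z].
  move=> y; case: (boolP (y \in Y)) => [/HY[_ [B B1 B2]]|_]; first by exists B.
  by exists finset.set0.
pose U := (\bigcup_(y in Y) B y)%SET.
have Bsep y y' w w' : y \in Y -> y' \in Y -> y != y' -> w \in B y -> w' \in B y' ->
    w != w' /\ ~~ adj w w'.
  move=> yY y'Y ne wB w'B'; have [[xy _] [xy' _]] := (HY _ yY, HY _ y'Y).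
  have [/fintype.subsetP sub _] := HB _ yY.
  have [/fintype.subsetP sub' _] := HB _ y'Y.
  by apply: (ball_from_separated girthG _ xy xy' ne (sub _ wB) (sub' _ w'B')); lia.
have inU y w : y \in Y -> w \in B y -> w \in U.
  by move=> yY wB; apply/finset.bigcupP; exists y.
exists U.
  apply/finset.bigcupsP => y yY; have [sub _] := HB _ yY.
  exact: fintype.subset_trans sub (finset.bigcup_sup _ yY).
move=> c rc.
have /choice[Fs HF] : forall y, exists F, y \in Y -> F \in fam y /\
    forall a, a \in colors -> a \in F ->
      exists c', [/\ in_range c', c' x = a, forall z, z \notin B y -> z != x -> c' z = c z,
        edge_ok l c' x y & forall w z, w \in B y -> adj w z -> edge_ok l c' w z].
  move=> y; case: (boolP (y \in Y)) => [/HB[_ /(_ _ rc)[F F1 F2]]|_]; first by exists F.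
  by exists [::].
exists Fs; first by move=> y /HF[].
move=> a aC aF.
have /choice[cs Hcs] : forall y, exists c', y \in Y ->
    [/\ in_range c', c' x = a, forall z, z \notin B y -> z != x -> c' z = c z,
        edge_ok l c' x y & forall w z, w \in B y -> adj w z -> edge_ok l c' w z].
  move=> y; case: (boolP (y \in Y)) => [yY|_]; last by exists c.
  by have [_ /(_ _ aC (aF _ yY))[c' Hc']] := HF _ yY; exists c'.
pose c' z := if [pick y in Y | z \in B y] is Some y then cs y z
             else if z == x then a else c z.
have c'B y z : y \in Y -> z \in B y -> c' z = cs y z.
  move=> yY zB; rewrite /c'; case: pickP => [y' /andP[y'Y zB']|/(_ y)]; last first.
    by rewrite yY zB.
  case: (eqVneq y y') => [->//|ne].
  by have [] := Bsep _ _ _ _ yY y'Y ne zB zB'; rewrite eqxx.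
have c'x : c' x = a.
  rewrite /c'; case: pickP => [y /andP[yY _]|_]; last by rewrite eqxx.
  by have [] := Hcs _ yY.
have c'out z : z \notin U -> z != x -> c' z = c z.
  move=> zU zx; rewrite /c' (negbTE zx); case: pickP => // y /andP[yY zB].
  by rewrite (inU _ _ yY zB) in zU.
have c'near y z : y \in Y -> z \notin U -> c' z = cs y z.
  move=> yY zU; have [_ csx csout _ _] := Hcs _ yY.
  have zB : z \notin B y by apply: contra zU; apply: inU.
  by case: (eqVneq z x) => [->|zx]; [rewrite c'x csx|rewrite c'out // csout].
exists c'; split=> //.
- move=> z; rewrite /c'; case: pickP => [y /andP[yY _]|_].
    by have [rcs _ _ _ _] := Hcs _ yY; apply: rcs.
  by case: ifP.
- move=> y yY; have [_ csx csout ok _] := Hcs _ yY.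
  move: ok; rewrite /edge_ok c'x csx.
  case: (boolP (y \in U)) => [/finset.bigcupP[y' y'Y yB']|yU]; last by rewrite (c'near y).
  case: (eqVneq y y') => [ey|ne]; first by rewrite (c'B y) // {2}ey.
  (* y lies in its own ball, so it is in no other branch *)
  have [xy _] := HY _ yY; have [xy' _] := HY _ y'Y.
  have [/fintype.subsetP sub' _] := HB _ y'Y.
  have [||] := @ball_from_separated G 1 k x y y' y y girthG _ xy xy' ne _ (sub' _ yB').
  + by lia.
  + by rewrite /= !inE eqxx.
  by rewrite eqxx.
- move=> w z /finset.bigcupP[y yY wB] wz; have [_ _ _ _ ok] := Hcs _ yY.
  have := ok w z wB wz; rewrite /edge_ok (c'B y w) //.
  case: (boolP (z \in U)) => [/finset.bigcupP[y' y'Y zB']|zU]; last by rewrite (c'near y).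
  case: (eqVneq y y') => [ey|ne]; first by rewrite (c'B y) // ey.
  by have [] := Bsep _ _ _ _ yY y'Y ne wB zB'; rewrite wz.
Qed.

Lemma branch_step (G : sgraph) (l : edge_labeling G) (u x : G) (Y : {set G})
  (fam : G -> seq (seq nat)) (fam' : seq (seq nat)) (k : nat) :
  girth_gt9 G -> k <= 3 -> adj u x ->
  (forall y, (y \in Y) = adj x y && (y != u)) ->
  (forall y, y \in Y -> branch l k x y (fam y)) ->
  (forall (Fs : G -> seq nat) lb, (forall y, y \in Y -> Fs y \in fam y) ->
    exists2 F, F \in fam' & forall a, a \in F ->
      exists2 b, b \in colors & compat lb a b /\ forall y, y \in Y -> b \in Fs y) ->
  branch l k.+1 u x fam'.
Proof.
move=> girthG k3 ux YE HY Hfam.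
have xY y : y \in Y -> adj x y by rewrite YE => /andP[].
have [U subU HU] := branches_extend girthG k3 (fun y yY => conj (xY y yY) (HY y yY)).
(* [u] is itself a ball of depth 1 seen from [x], so the separation of balls applies to it; giving
   [u] a new colour disturbs no edge at [U]. *)
have Usep w : w \in U -> w != u /\ ~~ adj w u.
  move=> /(fintype.subsetP subU)/finset.bigcupP[y yY wB].
  have yu : y != u by move: yY; rewrite YE => /andP[].
  apply: (ball_from_separated girthG _ (xY _ yY) _ yu wB).
  - by instantiate (1 := 1); lia.
  - by rewrite adj_sym.
  - by rewrite /= !inE eqxx.
have ux' : x != u by apply: contraTneq ux => ->; rewrite adj_irrefl.
exists (x |: U)%SET.
  rewrite /=; apply: finset.setUS; apply: fintype.subset_trans subU _.
  apply/finset.bigcupsP => y yY; apply: finset.bigcup_sup; by rewrite -YE.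
move=> c rc; have [Fs HF Hext] := HU c rc.
have [F FF HF'] := Hfam Fs (l [set u; x]%SET) HF; exists F => // a aC aF.
have [b bC [ab bF]] := HF' a aF.
have [c' [rc' c'x c'out okx okU]] := Hext b bC bF.
pose c2 z := if z == u then a else c' z.
have c2u : c2 u = a by rewrite /c2 eqxx.
have c2n z : z != u -> c2 z = c' z by rewrite /c2 => /negbTE ->.
exists c2; split=> //.
- by move=> z; rewrite /c2; case: ifP.
- move=> z; rewrite finset.in_setU1 negb_or => /andP[zx zU] zu.
  by rewrite c2n // c'out.
- by rewrite /edge_ok c2u c2n // c'x.
move=> y z; rewrite finset.in_setU1 => /predU1P[->|yU] yz.
  case: (eqVneq z u) => [->|zu].
    by rewrite edge_ok_sym /edge_ok c2u c2n // c'x.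
  have := okx z; rewrite YE yz zu => /(_ isT).
  by rewrite /edge_ok !c2n.
have [yu nyu] := Usep y yU.
have zu : z != u by apply: contraTneq yz => ->.
by have := okU y z yU yz; rewrite /edge_ok !c2n.
Qed.

Lemma fam_bad_def : fam_bad = fam_step (fam_meet fam1 fam2).
Proof. by []. Qed.

Lemma kind_fam1 : kind_fam 1 = fam_step fam0.
Proof. by []. Qed.

Lemma kind_fam2 : kind_fam 2 = fam_step fam1.
Proof. by []. Qed.

Opaque fam0 fam1 fam2 fam_bad.

(** * Kinds of neighbours and the branches they carry *)

Definition deg (G : sgraph) (v : G) : nat := #|[set x | adj v x]%SET|.

(** The count stops at two, because a third consecutive vertex of degree 2 is reducible. *)
Definition thread (G : sgraph) (u x : G) : nat :=
  if deg x == 2 then 1 + [exists y, [&& adj x y, y != u & deg y == 2]] else 0.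

(** For a neighbour [u] of [x], the condition on the degree of [u] makes its own thread 0. The total
    3 then comes from the two other neighbours, with at most 2 each: one carries 1 and the other
    2. *)
Definition bad (G : sgraph) (x u : G) : bool :=
  [&& deg x == 3, 2 < deg u & \sum_(y | adj x y) thread x y == 3].

Definition kind (G : sgraph) (u x : G) : nat := if bad x u then 3 else thread u x.

Lemma branch_mono (G : sgraph) (l : edge_labeling G) k k' (u x : G) fam :
  k <= k' -> branch l k u x fam -> branch l k' u x fam.
Proof.
move=> le [B sub HB]; exists B => //.
exact: fintype.subset_trans sub (ball_from_mono _ _ le).
Qed.

Lemma fam_stepP fam lb F : F \in fam -> reach lb F \in fam_step fam.
Proof.
move=> Ffam; rewrite mem_undup /= cats0 mem_cat.
by case: lb; rewrite map_f ?orbT.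
Qed.

Lemma fam_badP lb F F' : F \in fam1 -> F' \in fam2 ->
  reach lb [seq a <- F | a \in F'] \in fam_bad.
Proof.
rewrite fam_bad_def; move: fam1 fam2 => fam fam' FF FF'; apply: fam_stepP.
by rewrite mem_undup; apply/allpairsP; exists (F, F').
Qed.

Lemma fam0_colors : all (all (mem colors)) fam0.
Proof. by vm_compute. Qed.

Lemma fam1_colors : all (all (mem colors)) fam1.
Proof. by vm_compute. Qed.

Lemma reachP lb F a : a \in reach lb F -> exists2 b, b \in F & compat lb a b.
Proof. by rewrite mem_filter => /andP[/hasP[b bF ab] _]; exists b. Qed.

Lemma branch_colored (G : sgraph) (l : edge_labeling G) (u x : G) :
  adj u x -> branch l 0 u x fam0.
Proof.
move=> ux; have xu : x != u by apply: contraTneq ux => ->; rewrite adj_irrefl.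
exists finset.set0 => [|c rc]; first exact: finset.sub0set.
exists (reach (l [set u; x]%SET) [:: c x]).
  apply: fam_stepP; apply: (map_f (fun b => [:: b])); exact: rc.
move=> a aC /reachP[b]; rewrite inE => /eqP -> ab.
exists (fun z => if z == u then a else c z); split=> [z||z _|| y z].
- by case: ifP.
- by rewrite eqxx.
- by move/negbTE->.
- by rewrite /edge_ok eqxx (negbTE xu).
- by rewrite inE.
Qed.

Lemma branch_thread (G : sgraph) (l : edge_labeling G) k (u x y : G) fam :
  girth_gt9 G -> k <= 3 -> adj u x -> deg x = 2 -> adj x y -> y != u ->
  all (all (mem colors)) fam -> branch l k x y fam ->
  branch l k.+1 u x (fam_step fam).
Proof.
move=> girthG k3 ux dx xy yu famC br.
have xE z : adj x z -> z = u \/ z = y.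
  have /eqP eq : [set u; y]%SET == [set z | adj x z]%SET.
    rewrite eqEcard cards2 eq_sym yu -/(deg x) dx andbT.
    by apply/fintype.subsetP => w /set2P[]->; rewrite inE // adj_sym.
  by move=> xz; apply/set2P; rewrite eq inE.
apply: (@branch_step G l u x [set y]%SET (fun=> fam) _ k) => //.
- move=> z; rewrite inE; apply/eqP/andP => [->//|[/xE[->|//]]].
  by rewrite eqxx.
- by move=> z /set1P->.
move=> Fs lb HF; have Fy := HF y (set11 y); exists (reach lb (Fs y)).
  exact: fam_stepP.
move=> a /reachP[b bF ab]; exists b; last by split=> // z /set1P->.
by move/allP/(_ _ Fy)/allP: famC; apply.
Qed.

Lemma branch_bad (G : sgraph) (l : edge_labeling G) k (u x y z : G) :
  girth_gt9 G -> k <= 3 -> adj u x -> deg x = 3 -> adj x y -> adj x z ->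
  y != u -> z != u -> y != z ->
  branch l k x y fam1 -> branch l k x z fam2 ->
  branch l k.+1 u x fam_bad.
Proof.
move=> girthG k3 ux dx xy xz yu zu yz bry brz.
have xE w : adj x w -> w \in [set u; y; z]%SET.
  have /eqP -> : [set u; y; z]%SET == [set w | adj x w]%SET.
    rewrite eqEcard -/(deg x) dx; apply/andP; split.
      by apply/fintype.subsetP => v; rewrite !inE => /orP[/orP[]|]/eqP-> //; rewrite adj_sym.
    by rewrite finset.setUC cardsU1 cards2 !inE negb_or zu [z == y]eq_sym yz eq_sym yu.
  by rewrite inE.
apply: (@branch_step G l u x [set y; z]%SET (fun w => if w == y then fam1 else fam2) _ k) => //.
- move=> w; rewrite !inE; apply/orP/andP => [[]/eqP->//|[/xE]].
  by rewrite !inE => /orP[/orP[->|->]|->]; [|left|right].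
- move=> w /set2P[]->; first by rewrite eqxx.
  by rewrite eq_sym (negbTE yz).
move=> Fs lb HF; have Fy := HF y (set21 y z); have Fz := HF z (set22 y z).
rewrite eqxx in Fy; rewrite eq_sym (negbTE yz) in Fz.
exists (reach lb [seq a <- Fs y | a \in Fs z]).
  exact (fam_badP lb Fy Fz).
move=> a /reachP[b]; rewrite mem_filter => /andP[bz by_] ab; exists b.
  by apply: (allP (allP fam1_colors _ Fy)).
by split=> // w /set2P[]->.
Qed.

Lemma thread_le2 (G : sgraph) (u x : G) : thread u x <= 2.
Proof. by rewrite /thread; case: ifP => // _; case: existsP. Qed.

Lemma branch_of_thread (G : sgraph) (l : edge_labeling G) (u x : G) :
  girth_gt9 G -> adj u x -> branch l (thread u x) u x (kind_fam (thread u x)).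
Proof.
move=> girthG ux; rewrite /thread; case: eqP => [dx|_]; last exact: branch_colored.
have other (v w : G) : adj v w -> deg w = 2 -> exists2 z, adj w z & z != v.
  move=> vw dw; have /card_gt0P[z] : 0 < #|[set z | adj w z]%SET :\ v|.
    by have := cardsD1 v [set z | adj w z]%SET; rewrite -/(deg w) dw !inE adj_sym vw add1n => -[<-].
  by rewrite !inE => /andP[zv wz]; exists z.
case: existsP => [[y /and3P[xy yu /eqP dy]]|_].
  have [z yz zx] := other x y xy dy.
  rewrite (_ : 1 + true = 2) // kind_fam2.
  apply: (branch_thread (k := 1) girthG _ ux dx xy yu fam1_colors) => //.
  apply: (branch_thread (k := 0) girthG _ xy dy yz zx fam0_colors) => //.
  exact: branch_colored.
have [y xy yu] := other u x ux dx.
rewrite (_ : 1 + false = 1) // kind_fam1.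
apply: (branch_thread (k := 0) girthG _ ux dx xy yu fam0_colors) => //.
exact: branch_colored.
Qed.

Lemma branch_of_kind (G : sgraph) (l : edge_labeling G) (u x : G) :
  girth_gt9 G -> adj u x -> branch l 3 u x (kind_fam (kind u x)).
Proof.
move=> girthG ux; rewrite /kind; case: ifP => [/and3P[/eqP dx du /eqP sx]|_]; last first.
  by apply: branch_mono (branch_of_thread l girthG ux); rewrite ltnW // ltnS thread_le2.
have xu : adj x u by rewrite adj_sym.
have tu : thread x u = 0 by rewrite /thread gtn_eqF.
have [y [z [xy yu xz zu yz]]] : exists y z, [/\ adj x y, y != u, adj x z, z != u & y != z].
  have : 1 < #|[set w | adj x w]%SET :\ u|.
    by have := cardsD1 u [set w | adj x w]%SET; rewrite -/(deg x) dx !inE xu add1n => -[<-].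
  by case/card_gt1P => y [z [+ + yz]]; rewrite !inE => /andP[? ?] /andP[? ?]; exists y, z.
have sum2 : thread x y + thread x z <= 3.
  rewrite -sx (bigD1 y) //= (bigD1 z) /=; last by rewrite xz eq_sym.
  by rewrite addnA leq_addr.
have sum2' : 3 <= thread x y + thread x z.
  rewrite -sx (bigD1 u) //= tu add0n.
  have eq : #|[set w | adj x w && (w != u)]%SET| = 2.
    have := cardsD1 u [set w | adj x w]%SET; rewrite -/(deg x) dx !inE xu add1n => -[->].
    by apply: eq_card => w; rewrite !inE andbC.
  have /eqP E : [set y; z]%SET == [set w | adj x w && (w != u)]%SET.
    rewrite eqEcard eq cards2 yz andbT.
    by apply/fintype.subsetP => w /set2P[]->; rewrite inE ?xy ?xz.
  rewrite (eq_bigl (fun w => w \in [set y; z]%SET)); last by move=> w; rewrite E inE.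
  by rewrite big_setU1 ?inE //= big_set1.
have [[ty tz]|[ty tz]] : thread x y = 1 /\ thread x z = 2 \/
    thread x y = 2 /\ thread x z = 1.
  by have := thread_le2 x y; have := thread_le2 x z; lia.
- have bry := branch_of_thread l girthG xy; rewrite ty in bry.
  have brz := branch_of_thread l girthG xz; rewrite tz in brz.
  exact (branch_bad girthG (isT : 2 <= 3) ux dx xy xz yu zu yz
    (branch_mono (isT : 1 <= 2) bry) brz).
- have bry := branch_of_thread l girthG xy; rewrite ty in bry.
  have brz := branch_of_thread l girthG xz; rewrite tz in brz.
  rewrite eq_sym in yz.
  exact (branch_bad girthG (isT : 2 <= 3) ux dx xz xy zu yu yz
    (branch_mono (isT : 1 <= 2) brz) bry).
Qed.

(** * Discharging *)

Definition total_colorable8 (G : sgraph) (l : edge_labeling G) : Prop :=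
  exists2 c : G -> nat, in_range c & forall u v, adj u v -> edge_ok l c u v.

(** Minimality, expressed on [G] itself: deleting [S] amounts to ignoring the edges that meet it. *)
Definition critical_colorable (G : sgraph) (l : edge_labeling G) : Prop :=
  forall S : {set G}, S != finset.set0 -> exists2 c : G -> nat, in_range c &
    forall u v, u \notin S -> v \notin S -> adj u v -> edge_ok l c u v.

(** With [x] and its branch regions deleted, minimality gives a colouring. Whatever sets the
    branches then leave at [x], they share a colour, and that colour extends into all branches. *)
Lemma reducible_vertex (G : sgraph) (l : edge_labeling G) (x : G) :
  girth_gt9 G -> critical_colorable l ->
  reducible [seq kind x y | y <- enum [set y | adj x y]%SET] ->
  total_colorable8 l.
Proof.
move=> girthG crit red; set Y := [set y | adj x y]%SET in red.
have HY y : y \in Y -> adj x y /\ branch l 3 x y (kind_fam (kind x y)).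
  by rewrite inE => xy; split=> //; apply: branch_of_kind.
have [U _ HU] := branches_extend girthG (leqnn 3) HY.
have [|c rc cok] := crit (x |: U)%SET.
  by apply/set0Pn; exists x; rewrite setU11.
have [Fs HF Hext] := HU c rc.
have [||a aC aF] := @always_meetP G (fun y => kind_fam (kind x y)) (enum Y) colors _ Fs.
- by move: red; rewrite /reducible -map_comp.
- by move=> y; rewrite mem_enum => /HF.
have [|c' [rc' c'x c'out okx okU]] := Hext a aC.
  by move=> y yY; apply: aF; rewrite mem_enum.
exists c' => // u v uv.
case: (boolP (u \in U)) => uU; first exact: okU.
case: (boolP (v \in U)) => vU; first by rewrite edge_ok_sym; apply: okU; rewrite // adj_sym.
case: (eqVneq u x) => [ux|ux]; first by rewrite ux; apply: okx; rewrite inE -ux.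
case: (eqVneq v x) => [vx|vx].
  by rewrite edge_ok_sym vx; apply: okx; rewrite inE -vx adj_sym.
by rewrite /edge_ok !c'out //; apply: cok; rewrite // finset.in_setU1 negb_or ?ux ?vx.
Qed.

Lemma kind_in (G : sgraph) (u x : G) : kind u x \in kinds.
Proof.
rewrite /kind; case: ifP => // _; have := thread_le2 u x.
by case: (thread u x) => [|[|[|]]].
Qed.

Lemma kind_weight_le2 (G : sgraph) (u x : G) : kind_weight (kind u x) <= 2.
Proof.
have := thread_le2 u x; rewrite /kind; case: ifP => // _.
by case: (thread u x) => [|[|[|]]].
Qed.

Lemma thread_le_weight (G : sgraph) (u x : G) : thread u x <= kind_weight (kind u x).
Proof.
rewrite /kind; case: ifP => [/and3P[/eqP dx _ _]|_].
  by rewrite /thread dx.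
by have := thread_le2 u x; case: (thread u x) => [|[|[|]]].
Qed.

(* v has charge 4 deg v - 10 and sends the weight of the branch
   at x to each neighbour x. *)
Lemma discharging (G : sgraph) (l : edge_labeling G) (v : G) :
  girth_gt9 G -> critical_colorable l -> ~ total_colorable8 l ->
  10 + \sum_(x | adj v x) kind_weight (kind v x) <=
  4 * deg v + \sum_(x | adj v x) kind_weight (kind x v).
Proof.
move=> girthG crit ncol.
pose N (w : G) := enum [set y | adj w y]%SET.
have irr (w : G) : ~~ reducible [seq kind w y | y <- N w].
  by apply/negP => /(reducible_vertex girthG crit).
have sumN (w : G) (g : G -> nat) : \sum_(x | adj w x) g x = \sum_(x <- N w) g x.
  by rewrite big_enum /=; apply: eq_bigl => x; rewrite inE.
have sizeN (w : G) : size (N w) = deg w by rewrite -cardE.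
have memN (w x : G) : (x \in N w) = adj w x by rewrite mem_enum inE.
have uniqN (w : G) : uniq (N w) by apply: enum_uniq.
have deg2 (w : G) : 2 <= deg w.
  move: (irr w) (sizeN w); case: (N w) => [|x [|y s]] //= + <- //.
  by rewrite reducible1 // kind_in.
have thread0 (w x : G) : deg x != 2 -> thread w x = 0.
  by rewrite /thread => /negbTE ->.
have thread_in12 (w x : G) : deg w = 2 -> deg x = 2 -> kind w x \in [:: 1; 2].
  move=> dw dx; rewrite /kind /bad dx /= /thread dx /=.
  by case: existsP.
have nbr2 (w x y : G) : N w = [:: x; y] -> deg x = 2 -> deg y = 2 -> False.
  move=> Nw dx dy; have dw : deg w = 2 by rewrite -sizeN Nw.
  by move: (irr w); rewrite Nw /= reducible2 // thread_in12.
have in2 (x : G) : adj v x -> deg v = 2 -> 1 <= kind_weight (kind x v).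
  move=> vx dv; apply: leq_trans (thread_le_weight x v).
  by rewrite /thread dv eqxx.
have out0 (x : G) : deg v = 2 -> deg x != 2 -> kind v x = 0.
  by move=> dv dx; rewrite /kind /bad dv andbF thread0.
(* A thread of two: [v] receives 2 from the large end [x], while [v] and [y] owe each other 1. The
   net gain 2 covers the deficit 10 - 4 * 2. *)
have mixed (x y : G) : deg v = 2 -> adj v x -> adj v y -> x != y ->
    deg x != 2 -> deg y = 2 ->
    kind_weight (kind v x) + kind_weight (kind v y) + 2 <=
    kind_weight (kind x v) + kind_weight (kind y v).
  move=> dv vx vy xy dx dy; rewrite out0 // (_ : kind_weight 0 = 0) //.
  have -> : kind v y = 1.
    rewrite /kind /bad dy /= /thread dy /=; case: existsP => // -[z /and3P[yz zv /eqP dz]].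
    have := uniqN y; have := memN y z; have := memN y v; have := @nbr2 y.
    have := sizeN y; rewrite dy yz adj_sym vy.
    case: (N y) => [|p [|q [|]]] // _ /(_ p q erefl) bad2; rewrite !inE => vpq zpq _.
    have [[pE qE]|[pE qE]] : p = v /\ q = z \/ p = z /\ q = v.
      case/orP: vpq => /eqP vE; case/orP: zpq => /eqP zE; [|by left|by right|];
        by rewrite vE zE eqxx in zv.
      by case: bad2; rewrite ?pE ?qE.
    by case: bad2; rewrite ?pE ?qE.
  have x2 : 2 <= kind_weight (kind x v).
    apply: leq_trans (thread_le_weight x v); rewrite /thread dv eqxx.
    case: existsP => // -[]; exists y; rewrite vy dy eqxx andbT /=.
    by rewrite eq_sym.
  by have := in2 y vy dv; rewrite (_ : kind_weight 1 = 1) //; lia.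
have [dv|dv] : deg v = 2 \/ 2 < deg v by have := deg2 v; lia.
  rewrite !sumN; have := memN v; have := sizeN v; have := uniqN v; have := @nbr2 v.
  rewrite dv; case: (N v) => [|x [|y [|]]] // /(_ x y erefl) n2 /=.
  rewrite inE andbT => xy _ mem; rewrite !big_cons !big_nil !addn0.
  have vx : adj v x by rewrite -mem !inE eqxx.
  have vy : adj v y by rewrite -mem !inE eqxx orbT.
  case: (eqVneq (deg x) 2) => dx; case: (eqVneq (deg y) 2) => dy.
  - by case: n2.
  - have yx : y != x by rewrite eq_sym.
    have := mixed y x dv vy vx yx dy dx; lia.
  - have := mixed x y dv vx vy xy dx dy; lia.
  - have := in2 x vx dv; have := in2 y vy dv; rewrite !out0 // (_ : kind_weight 0 = 0) //; lia.
(* From degree 5 on, this suffices: 2 d <= 4 d - 10. *)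
have le2 : \sum_(x | adj v x) kind_weight (kind v x) <= 2 * deg v.
  rewrite mulnC /deg -sum_nat_const [leqRHS](eq_bigl (fun x => adj v x)); last first.
    by move=> x; rewrite inE.
  by apply: leq_sum => x _; apply: kind_weight_le2.
have [d5|[d3|d4]] : 4 < deg v \/ (deg v = 3 \/ deg v = 4) by lia.
- by lia.
  have [|gt2] := leqP (\sum_(x | adj v x) kind_weight (kind v x)) 2; first lia.
  have perm : perm_eq [:: 0; 1; 2] [seq kind v y | y <- N v].
    apply/negPn/negP => np; move: (irr v) np gt2; rewrite sumN; have := sizeN v.
    rewrite d3; case: (N v) => [|x [|y [|z [|]]]] //= _ /negP irrv np.
    rewrite !big_cons big_nil addn0 addnA => gt2; apply: irrv.
    by apply: reducible3 => //; apply: kind_in.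
  have kind012 x : adj v x -> kind v x \in [:: 0; 1; 2].
    by move=> vx; rewrite (perm_mem perm) map_f // memN.
  have notbad x : adj v x -> kind v x = thread v x.
    by move=> /kind012; rewrite /kind; case: ifP.
  have sum3 (g : nat -> nat) : \sum_(x | adj v x) g (kind v x) = g 0 + g 1 + g 2.
    rewrite sumN -(big_map (kind v) xpredT g) -(perm_big _ perm) /=.
    by rewrite !big_cons big_nil addn0 addnA.
  have /mapP[u uN ku] : 0 \in [seq kind v y | y <- N v] by rewrite -(perm_mem perm).
  have vu : adj v u by rewrite -memN.
  (* The neighbour [u] of kind 0 has degree above 2, and the other two threads total 3; so [u] sees
     [v] as bad and sends the missing unit. *)
  have badv : bad v u.
    rewrite /bad d3 /=; apply/andP; split.
      have tu : thread v u = 0 by rewrite -notbad.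
      have := deg2 u; rewrite leq_eqVlt => /predU1P[du|//].
      by move: tu; rewrite /thread -du.
    by rewrite -(eq_bigr _ notbad) (sum3 id).
  have kuv : kind_weight (kind u v) = 1 by rewrite /kind badv.
  by rewrite (sum3 kind_weight) d3 [X in _ <= _ + X](bigD1 u) //= kuv.
have [|gt6] := leqP (\sum_(x | adj v x) kind_weight (kind v x)) 6; first lia.
move: (irr v) gt6; rewrite sumN; have := sizeN v.
rewrite d4; case: (N v) => [|x [|y [|z [|w [|]]]]] //= _ /negP irrv.
rewrite !big_cons big_nil addn0 !addnA => gt6; case: irrv.
by apply: reducible4 => //; apply: kind_in.
Qed.

Lemma sum_deg (G : sgraph) : \sum_(v : G) deg v <= 2 * #|edges G|.
Proof.
have -> : 2 * #|edges G| = \sum_(E in edges G) #|E|.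
  rewrite mulnC -sum_nat_const; apply: eq_bigr => E /edgesP[u [v [uv ->]]].
  by rewrite cards2; case: eqP uv => // ->; rewrite adj_irrefl.
have -> : \sum_(E in edges G) #|E| = \sum_(v : G) #|[set E in edges G | v \in E]%SET|.
  rewrite (eq_bigr (fun E : {set G} => \sum_(v : G) (v \in E : nat))).
    rewrite exchange_big /=; apply: eq_bigr => v _.
    rewrite -sum1_card big_mkcond [RHS]big_mkcond /=; apply: eq_bigr => E _.
    by rewrite [in RHS]finset.in_set; case: (E \in edges G); case: (v \in E).
  by move=> E _; rewrite -sum1_card big_mkcond; apply: eq_bigr => v _; case: (v \in E).
apply: leq_sum => v _; rewrite /deg.
have inj : {in [set x | adj v x]%SET &, injective (fun x => [set v; x]%SET)}.
  move=> x y; rewrite !inE => vx vy eq.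
  have /set2P[xv|//] : x \in [set v; y]%SET by rewrite -eq !inE eqxx orbT.
  by rewrite xv adj_irrefl in vx.
rewrite -(card_in_imset inj); apply: subset_leq_card.
apply/fintype.subsetP => E /imsetP[x vx ->]; rewrite inE in vx.
by rewrite finset.in_set set21 andbT; apply/edgesP; exists v, x.
Qed.

(** Summed over all vertices, the transfers cancel and leave 10 n <= 8 m. *)
Lemma critical_total_colorable (G : sgraph) (l : edge_labeling G) :
  girth_gt9 G -> 4 * #|edges G| < 5 * #|G| -> critical_colorable l ->
  total_colorable8 l.
Proof.
move=> girthG sparse crit; apply: contrapT => ncol.
have : \sum_(v : G) (10 + \sum_(x | adj v x) kind_weight (kind v x)) <=
    \sum_(v : G) (4 * deg v + \sum_(x | adj v x) kind_weight (kind x v)).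
  by apply: leq_sum => v _; exact: discharging girthG crit ncol.
rewrite big_split [leqRHS]big_split /=.
have -> : \sum_(v : G) 10 = #|G| * 10.
  by rewrite sum_nat_const; congr (_ * _); apply: eq_card.
have -> : \sum_(v : G) 4 * deg v = 4 * \sum_(v : G) deg v by rewrite big_distrr.
have -> : \sum_(v : G) \sum_(x | adj v x) kind_weight (kind v x) =
    \sum_(v : G) \sum_(x | adj v x) kind_weight (kind x v).
  rewrite (exchange_big_dep xpredT) //=; apply: eq_bigr => v _.
  by apply: eq_bigl => x; rewrite adj_sym.
rewrite leq_add2r => le; have := sum_deg G; lia.
Qed.

(** * Induction on induced subgraphs *)

Definition induced (G : sgraph) (W : {set G}) : sgraph :=
  @SGraph {x : G | x \in W} (relpre val (@adj G))
    (fun x y => adj_sym (val x) (val y)) (fun x => adj_irrefl (val x)).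

Lemma induced_girth (G : sgraph) (W : {set G}) :
  girth_gt9 G -> girth_gt9 (induced W).
Proof.
move=> girthG p [/andP[cyc up] p3]; rewrite -(size_map val p); apply: girthG.
split; last by rewrite size_map.
by apply/andP; split; [rewrite cycle_map|rewrite map_inj_uniq //; exact: val_inj].
Qed.

Lemma induced_edges (G : sgraph) (W : {set G}) (E : {set induced W}) :
  E \in edges (induced W) -> val @: E \in edges G.
Proof.
case/edgesP => u [v [uv ->]]; apply/edgesP; exists (val u), (val v).
by rewrite imsetU !imset_set1.
Qed.

Lemma induced_planar (R : realType) (G : sgraph) (W : {set G}) :
  planar R G -> planar R (induced W).
Proof.
case=> pos [arc [posinj arcP vertexP disjP]].
exists (pos \o val), (fun E : {set induced W} => arc (val @: E)); split.
- by move=> x y /posinj/val_inj.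
- by move=> u v uv; rewrite imsetU !imset_set1; apply: arcP.
- move=> E EG w /(vertexP _ (induced_edges EG)) /imsetP[x xE].
  by move/val_inj->.
move=> E E' EG E'G ne p pE.
have [|w [wE wE'] <-] := disjP _ _ (induced_edges EG) (induced_edges E'G) _ p pE.
  by rewrite (inj_eq (imset_inj val_inj)).
case/imsetP: wE wE' => x xE -> /imsetP[x' xE' /val_inj xx'].
by exists x => //; split=> //; rewrite xx'.
Qed.

Lemma total_colorable8P (G : sgraph) (l : edge_labeling G) :
  total_colorable8 l -> exists c, threshold_coloring 8 2 l c.
Proof.
case=> c rc cok; exists c; split=> [v|u v uv].
  by have := rc v; rewrite mem_iota.
have -> : (`|(c u)%:Z - (c v)%:Z| <= 2%:Z)%R = (c u <= c v + 2) && (c v <= c u + 2).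
  by rewrite ler_norml; apply/andP/andP => -[? ?]; split; lia.
have := cok u v uv; rewrite /edge_ok /compat.
by case: (l [set u; v]%SET) => [-> //|/negP H]; split.
Qed.

Lemma girth10_total_colorable (R : realType) (G : sgraph) (l : edge_labeling G) :
  planar R G -> girth_gt9 G -> total_colorable8 l.
Proof.
move: {2}#|G| (leqnn #|G|) => n; elim: n G l => [|n IH] G l le planarG girthG.
  have no (v : G) : False by move: le; rewrite leqn0 => /eqP/card0_eq/(_ v).
  by exists (fun=> 1) => v; case: (no v).
case: (pickP G) => [v0 _|no]; last by exists (fun=> 1) => v; have := no v.
apply: critical_total_colorable => //; first exact: (planar_sparse v0 planarG).
move=> S /set0Pn[x xS].
have [|||c rc cok] := IH (induced (~: S)) (fun E : {set induced (~: S)} => l (val @: E)).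
- rewrite card_sig -ltnS; apply: leq_trans le.
  apply: proper_card; apply/properP; split; first exact/fintype.subsetP.
  by exists x => //; rewrite !inE xS.
- exact: induced_planar.
- exact: induced_girth.
(* Vertices of [S] receive an arbitrary colour in range; no edge at them is constrained. *)
exists (fun z => if insub z is Some s then c s else 1).
  by move=> z; case: insubP => [s _ _|_].
move=> u v uS vS uv; have uC : u \in ~: S by rewrite inE.
have vC : v \in ~: S by rewrite inE.
have := cok (Sub u uC) (Sub v vC) uv.
by rewrite /edge_ok imsetU !imset_set1 /= !insubT.
Qed.

Theorem theorem3 (R : realType) (G : sgraph)
  (planarG : planar R G)
  (girthG : forall p : seq G, graph_cycle p -> ~~ (size p <= 9)%N) :
  total_threshold_colorable 8 2 G.
Proof.
by move=> l; apply: total_colorable8P; apply: girth10_total_colorable planarG girthG.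
Qed.
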